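(* Let $n\geq 2$, $m\geq 1$, $N\geq 2$, and let $A=\{\alpha_1,\ldots,\alpha_m\}$ be a set of numbers $-1<\alpha_1<\ldots<\alpha_m<1$ symmetric about the origin. Suppose there exists an equi-weighted $N$-point $(m-1,m-1)$-design $C^\ast=\{x_1^\ast,\ldots,x_N^\ast\}\subset \mathbb{S}^{n-1}$ with no antipodal pairs and with $x_i^\ast\cdot x_j^\ast\in A$, $1\leq i\neq j\leq N$. Let $f:[0,1]\to \mathbb R$ be a continuous function such that $f^{(k)}\geq 0$ in $(0,1)$ for $k=1,\ldots,m$. Suppose $(C,W)=(x_1,\ldots,x_N;w_1,\ldots,w_N)$ is any weighted code of $N$ distinct points on $\mathbb{S}^{n-1}$, where $W=(w_1,\ldots,w_N)$ is any vector of non-negative numbers that add up to $1$. Then $$E_f(C,W)=\sum_{i,j=1}^{N}w_iw_jf\left((x_i\cdot x_j)^2\right)\geq E_f(C^\ast,W^\ast)=\frac {1}{N^2}\sum_{i,j=1}^{N}f\left((x_i^\ast\cdot x_j^\ast)^2\right),\qquad( * )$$ where $W^\ast=\left(\frac {1}{N},\ldots,\frac {1}{N}\right)\in \mathbb R^N$. Assume, in addition, that $f^{(k)}>0$ on $(0,1)$ for $k=1,\ldots,m$. Then equality holds in $( * )$ if and only if $(C,W)$ is an equi-weighted $(m-1,m-1)$-design with no antipodal pairs and dot products between distinct points lying in $A$.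
   Context: $\mathbb S^{n-1}$ is the unit sphere in $\mathbb R^n$ and $x\cdot y$ is the standard dot product. $P_k^{(n)}$ is the Gegenbauer polynomial of degree $k$: the polynomial of degree $k$ orthogonal to all polynomials of degree less than $k$ on $[-1,1]$ with weight $(1-t^2)^{(n-3)/2}$, normalized by $P_k^{(n)}(1)=1$. For pairwise distinct points $x_1,\ldots,x_N\in\mathbb S^{n-1}$ and non-negative weights $w_1,\ldots,w_N$ with sum $1$, write $(C,W)=(x_1,\ldots,x_N;w_1,\ldots,w_N)$, $C=\{x_1,\ldots,x_N\}$, $W=(w_1,\ldots,w_N)$. $(C,W)$ is a weighted $(k,k)$-design, $k\ge1$, if $\sum_{i,j=1}^{N}w_iw_jP_{2\ell}^{(n)}(x_i\cdot x_j)=0$ for $\ell=1,\ldots,k$; every such $(C,W)$ is a $(0,0)$-design. It is equi-weighted if all weights equal $1/N$. An antipodal pair is a pair $\{x,-x\}$. The $f$-energy is $E_f(C,W):=\sum_{i,j=1}^{N}w_iw_jf\left((x_i\cdot x_j)^2\right)$. Conditions on $f^{(k)}$ on $(0,1)$ include the existence of these derivatives there. *)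

(* Defs.v *)
From mathcomp Require Import all_boot all_order all_algebra.
From mathcomp Require Import all_classical all_reals all_analysis.

Set Implicit Arguments.
Unset Strict Implicit.
Unset Printing Implicit Defensive.

Import Order.TTheory GRing.Theory Num.Theory.
Import numFieldNormedType.Exports.

Local Open Scope classical_set_scope.
Local Open Scope ring_scope.

Definition dot (R : realType) (n : nat) (x y : 'rV[R]_n) : R :=
  \sum_(i < n) x 0 i * y 0 i.

Definition on_sphere (R : realType) (n : nat) (x : 'rV[R]_n) : Prop :=
  dot x x = 1.

(* For n = 2 the weight is singular at -1 and 1, where [powR] returns 0; these
   two points are negligible, so the integrals below are not affected. *)
Definition gegenbauer_weight (R : realType) (n : nat) (t : R) : R :=
  (1 - t ^+ 2) `^ ((n%:R - 3%:R) / 2%:R).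

(* [size] is the degree plus one. The integral is the extended-real one, so
   that its vanishing cannot come from truncating an infinite value. *)
Definition is_gegenbauer (R : realType) (n k : nat) (p : {poly R}) : Prop :=
  [/\ size p = k.+1,
      forall q : {poly R}, (size q <= k)%N ->
        (\int[lebesgue_measure]_(t in `[(-1 : R)%R, 1%R])
           (p.[t] * q.[t] * gegenbauer_weight n t)%:E = 0)%E
    & p.[1] = 1].

(* The default value 0 of [xget] is irrelevant: for n >= 2 there is exactly one
   polynomial satisfying [is_gegenbauer n k]. *)
Definition gegenbauer (R : realType) (n k : nat) : {poly R} :=
  xget 0 [set p : {poly R} | is_gegenbauer n k p].

Definition weighted_code (R : realType) (n N : nat)
    (x : 'I_N -> 'rV[R]_n) (w : 'I_N -> R) : Prop :=
  [/\ injective x, forall i, on_sphere (x i),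
      forall i, 0 <= w i & \sum_(i < N) w i = 1].

(* For k = 0 the range of l is empty, so every weighted code is a
   (0,0)-design. *)
Definition is_design (R : realType) (n N k : nat)
    (x : 'I_N -> 'rV[R]_n) (w : 'I_N -> R) : Prop :=
  weighted_code x w /\
  forall l : nat, (1 <= l <= k)%N ->
    \sum_(i < N) \sum_(j < N)
      w i * w j * (gegenbauer R n (2 * l)%N).[dot (x i) (x j)] = 0.

Definition equi_weights (R : realType) (N : nat) : 'I_N -> R :=
  fun=> N%:R^-1.

Definition no_antipodal_pairs (R : realType) (n N : nat)
    (x : 'I_N -> 'rV[R]_n) : Prop :=
  forall i j, x i != - x j.

Definition dots_in (R : realType) (n N : nat) (A : set R)
    (x : 'I_N -> 'rV[R]_n) : Prop :=
  forall i j, i != j -> A (dot (x i) (x j)).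

Definition energy (R : realType) (n N : nat) (f : R -> R)
    (x : 'I_N -> 'rV[R]_n) (w : 'I_N -> R) : R :=
  \sum_(i < N) \sum_(j < N) w i * w j * f (dot (x i) (x j) ^+ 2).

(* [derive1n] is total, so the existence of the first m derivatives on (0,1)
   is a separate condition. *)
Definition derivable_upto (R : realType) (m : nat) (f : R -> R) : Prop :=
  forall k : nat, (k < m)%N ->
    {in `]0, 1[, forall t : R, derivable (derive1n k f) t 1}.

(* Main.v *)
Require Import Defs.
From mathcomp Require Import all_boot all_order all_algebra.
From mathcomp Require Import all_classical all_reals all_analysis.
From mathcomp Require Import measurable_realfun ring lra zify.

(** The proof is a linear programming bound by Hermite interpolation, in the
variable [u = t ^ 2], where [t] is an inner product.

The squares of the elements of [A], with [0] counted once and each other square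
twice, form a list of [m] nodes in [[0, 1)]. Let [g] be the Hermite interpolant of [f] at these nodes, in Newton
form [g = \sum_i c_i pi_i] with [pi_i] the product of the first [i] factors
[u - node]. As [f ^ (k) >= 0], the divided differences [c_i], [i > 0], are
nonnegative ([newton_hermite]) and [g <= f] on [[0, 1]] ([hermite_le]). If each
kernel [pi_i ((x . y) ^ 2)] is positive definite on the sphere, then the
[pi_i]-energy of any weighted code is at least the spherical mean of [pi_i],
because the design [C*] has this mean as its average around every point
([design_exact], [psd_energy_ge]). The energy excess over [C*] becomes a sum of
three nonnegative terms ([energy_decomposition]): the excess of the
[pi_i]-energies, the error [f - g] on the pairs of distinct points, and the
variance of the weights. Under strict positivity, each of them vanishes only in
the expected case ([universal_optimality]).

The main point is thus the positive definiteness of the [pi_i]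
([psd_prefix]). It rests on two facts.

First, the Gegenbauer polynomials are positive definite. The usual addition
theorem is replaced by an induction on the degree ([raising_both]): the
projection of [x_i h (x)] to the harmonic polynomials is given by a first order
differential operator, and applying these operators to both variables of the
zonal kernel of degree [d] gives a positive multiple of the one of degree
[d + 1]. Hence these kernels are finite sums of products [phi (x) phi (y)]
([zonal_features]), a form that is visibly stable by products. They are
identified with the polynomials orthogonal for the weight
[(1 - t ^ 2) ^ ((n - 3) / 2)] by the Gegenbauer differential equation
([gegenbauer_zonal]).

Second, [pi_i] is a product of two prefix products of the simple nodes (up to
[u] if [0] is in [A]). Averaging over the pairs of points of [C*] defines a
positive discrete functional on these nodes and [1], and the strength of the
design says that its first orthogonal polynomials are Gegenbauer polynomials.
For any positive functional on nodes [r_0 < r_1 < ...], the products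
[(u - r_0) ... (u - r_k)] over initial segments have nonnegative coefficients
in the orthogonal polynomials ([prefix_products_in_cone]); this is shown by
removing the largest node repeatedly ([remove_node]). *)

Set Implicit Arguments.
Unset Strict Implicit.
Unset Printing Implicit Defensive.

Import Order.TTheory GRing.Theory Num.Theory.
Import numFieldNormedType.Exports.

Local Open Scope classical_set_scope.
Local Open Scope ring_scope.

(** * Homogeneous Gegenbauer polynomials *)

Section Ultraspherical.
Variables (A : comNzRingType) (n : nat).

(** Up to the factor [j`!], [ultraW] and [ultraU] are the Gegenbauer
    polynomials of parameters [n / 2 + 1] and [n / 2], and [zonal] is a positive
    multiple of the one of parameter [n / 2 - 1], all homogenized with [s] of
    degree 1 and [a] of degree 2. The factor [j`!] clears the denominators, so
    that the same recursion makes sense in every commutative ring. The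
    parameter [n / 2 - 1] vanishes for [n = 2], where [zonal] still gives the
    Chebyshev polynomials. *)
Fixpoint ultraW (s a : A) (j : nat) : A :=
  if j is j1.+1 then
    (2 * j1 + 2 + n)%:R * s * ultraW s a j1 -
    (if j1 is j2.+1 then (j1 * (j1 + 1 + n))%:R * a * ultraW s a j2 else 0)
  else 1.

Definition ultraU (s a : A) (j : nat) : A :=
  if j is j1.+1 then
    n%:R * (s * ultraW s a j1 - j1%:R * a * ultraW s a j1.-1)
  else 1.

Definition zonal (s a : A) (d : nat) : A :=
  if d is e.+1 then s * ultraU s a e - e%:R * a * ultraU s a e.-1 else 1.

Lemma ultraWS s a j : ultraW s a j.+1 =
  (2 * j + 2 + n)%:R * s * ultraW s a j
  - (j * (j + 1 + n))%:R * a * ultraW s a j.-1.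
Proof. by case: j => [|j] //=; rewrite mul0n !mul0r. Qed.

(** This identity, [ultraU_W2] and the definition of [ultraU] stand for
    all the relations between contiguous parameters; the recurrences below
    follow from them. *)
Lemma ultraU_W s a j : (j + n)%:R * ultraU s a j =
  n%:R * (ultraW s a j - j%:R * s * ultraW s a j.-1).
Proof.
case: j => [|j] /=; first by rewrite mul0r mul0r subr0.
rewrite -/(ultraW s a j.+1) ultraWS !natrD !natrM !natrD -addn1 !natrD; ring.
Qed.

Lemma ultraU_W2 s a j : (2 * j + n)%:R * ultraU s a j =
  n%:R * (ultraW s a j - (j * j.-1)%:R * a * ultraW s a j.-2).
Proof.
rewrite mul2n -addnn -addnA natrD mulrDl ultraU_W.
case: j => [|j] /=; first by ring.
rewrite !natrM; ring.
Qed.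

Lemma ultraUS s a j : ultraU s a j.+1 =
  (2 * j + n)%:R * s * ultraU s a j
  - (j * (j + n).-1)%:R * a * ultraU s a j.-1.
Proof.
case: j => [|j]; first by rewrite /=; ring.
have h2 := ultraU_W2 s a j.+1; have h1 := ultraU_W s a j.
have -> : (j.+1 * (j.+1 + n).-1)%:R * a * ultraU s a j.+1.-1 =
    j.+1%:R * a * ((j + n)%:R * ultraU s a j) by rewrite addSn natrM /=; ring.
rewrite h1 mulrAC h2 /= natrM; ring.
Qed.

Lemma zonal_ultraU s a d : (2 * d + n)%:R * zonal s a d.+1 =
  ultraU s a d.+1 - (d.+1 * d)%:R * a * ultraU s a d.-1.
Proof.
rewrite ultraUS; case: d => [|d] /=; first by ring.
rewrite !natrM !natrD !natrM -addn1 !natrD; ring.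
Qed.
End Ultraspherical.
Section UltrasphericalDerivation.
Variables (A : comNzRingType) (n : nat).
Implicit Types s a : A.

Let coefs s a j : (2 * j.+1 + n)%:R * ultraU n s a j.+1
   + (2 * j.+1 + n)%:R * s * (n%:R * (j.+1%:R * ultraW n s a j))
   - (j.+1 * (j + n))%:R * a * (n%:R * (j%:R * ultraW n s a j.-1))
  = n%:R * (j.+2%:R * ultraW n s a j.+1).
Proof.
rewrite ultraU_W2 ultraWS.
rewrite !natrM !natrD !natrM -addn1 -[j.+2]addn2 !natrD /=; ring.
Qed.

Let coefa s a j : j.+1%:R * ((j + n)%:R * ultraU n s a j)
   + (2 * j.+1 + n)%:R * s * (n%:R * (('C(j.+1, 2))%:R * ultraW n s a j.-1))
   - (j.+1 * (j + n))%:R * a * (n%:R * (('C(j, 2))%:R * ultraW n s a j.-2))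
  = n%:R * (('C(j.+2, 2))%:R * ultraW n s a j).
Proof.
rewrite ultraU_W (binS j.+1 1) bin1.
case: j => [|i]; first by rewrite !bin_small //=; ring.
rewrite (binS i.+1 1) bin1 ultraWS /=.
have : 2 * ('C(i.+1, 2))%:R - i.+1%:R * i%:R = 0 :> A.
  by apply/eqP; rewrite subr_eq0 -!natrM bin2 mul2n halfK oddM /= andNb subn0.
set c := 'C(i.+1, 2) => h; apply/eqP; rewrite -subr_eq0; apply/eqP.
rewrite -[RHS](mulr0 (n%:R * (s * ultraW n s a i
   - (i + 1 + n)%:R * a * ultraW n s a i.-1))) -h.
rewrite !natrM !natrD !natrM -[i.+2]addn2 -!(addn1 i) !natrD; ring.
Qed.

Variable Der : A -> A -> Prop.
Hypothesis DerC : forall k : nat, Der k%:R 0.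
Hypothesis DerB : forall x x' y y', Der x x' -> Der y y' -> Der (x - y) (x' - y').
Hypothesis DerM : forall x x' y y',
  Der x x' -> Der y y' -> Der (x * y) (x' * y + x * y').

Let DerCM k x x' : Der x x' -> Der (k%:R * x) (k%:R * x').
Proof. by move=> dx; have := DerM (DerC k) dx; rewrite mul0r add0r. Qed.

(** A derivation raises the parameter by one, which is the reason for
    introducing [ultraW]. *)
Lemma der_ultraU s s' a a' (ds : Der s s') (da : Der a a') j :
  Der (ultraU n s a j)
    (n%:R * (j%:R * ultraW n s a j.-1 * s' - ('C(j, 2))%:R * ultraW n s a j.-2 * a')).
Proof.
suff [] : Der (ultraU n s a j)
    (n%:R * (j%:R * ultraW n s a j.-1 * s' - ('C(j, 2))%:R * ultraW n s a j.-2 * a'))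
  /\ Der (ultraU n s a j.+1)
    (n%:R * (j.+1%:R * ultraW n s a j * s'
             - ('C(j.+1, 2))%:R * ultraW n s a j.-1 * a')) by [].
elim: j => [|j [IH1 IH2]].
  split; first by rewrite bin0n /= !mul0r subr0 mulr0; exact: (DerC 1).
  rewrite /= bin_small // !mul0r subr0 !mulr1 mul1r subr0; exact: DerCM.
split => //; rewrite ultraUS addSn -!mulrA.
have := DerB (DerCM (2 * j.+1 + n)%N (DerM ds IH2))
  (DerCM (j.+1 * (j + n))%N (DerM da IH1)).
congr Der.
rewrite [RHS](_ : _ = s' * (n%:R * (j.+2%:R * ultraW n s a j.+1))
   - a' * (n%:R * (('C(j.+2, 2))%:R * ultraW n s a j))); last by rewrite /=; ring.
rewrite -coefs -coefa !natrM /=; ring.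
Qed.

Lemma der_zonal s s' a a' (ds : Der s s') (da : Der a a') d :
  Der (zonal n s a d)
    (d%:R * ultraU n s a d.-1 * s' - ('C(d, 2))%:R * ultraU n s a d.-2 * a').
Proof.
case: d => [|[|d]].
- by rewrite bin_small // !mul0r subr0; exact: (DerC 1).
- by rewrite /= bin_small // !mul0r !subr0 !(mulr1, mul1r).
have -> : zonal n s a d.+2 = s * ultraU n s a d.+1 - d.+1%:R * (a * ultraU n s a d).
  by rewrite [RHS]/= [LHS]/= !mulrA.
have := DerB (DerM ds (der_ultraU ds da d.+1)) (DerCM d.+1 (DerM da (der_ultraU ds da d))).
congr Der.
have e1 : d.+2%:R * ultraU n s a d.+1 = ultraU n s a d.+1
   + d.+1%:R * (n%:R * (s * ultraW n s a d - d%:R * a * ultraW n s a d.-1)).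
  by rewrite /= -[d.+2]addn1 natrD; ring.
have e2 : ('C(d.+1, 2))%:R * ultraU n s a d =
   n%:R * (('C(d.+1, 2))%:R * s * ultraW n s a d.-1
           - d.+1%:R * ('C(d, 2))%:R * a * ultraW n s a d.-2).
  case: d {e1} => [|e]; first by rewrite bin_small // bin0n /=; ring.
  have h : e%:R * ('C(e.+2,2))%:R = e.+2%:R * ('C(e.+1,2))%:R :> A.
    by rewrite -!natrM; have := mul_bin_down e.+2 2; rewrite !subSS subn0 /= => ->.
  rewrite -[e.+2%:R * _]h /=; ring.
rewrite [RHS](_ : _ = s' * (d.+2%:R * ultraU n s a d.+1)
   - a' * (('C(d.+2, 2))%:R * ultraU n s a d)); last by ring.
rewrite e1 (binS d.+1 1) bin1 natrD mulrDl e2 /=; ring.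
Qed.
End UltrasphericalDerivation.

(** * Polynomial expressions and their partial derivatives *)

Section UltrasphericalMorphism.
Variables (A B : comNzRingType) (n : nat) (g : {rmorphism A -> B}).

Lemma rmorph_ultraW s a j : g (ultraW n s a j) = ultraW n (g s) (g a) j.
Proof.
elim/ltn_ind: j => -[|j] IH; first by rewrite /= rmorph1.
rewrite !ultraWS rmorphB !rmorphM !rmorph_nat IH //.
by case: j IH => [|j] IH; rewrite ?mul0n ?mul0r //= IH.
Qed.

Lemma rmorph_ultraU s a j : g (ultraU n s a j) = ultraU n (g s) (g a) j.
Proof.
case: j => [|j] /=; first by rewrite rmorph1.
by rewrite rmorphM rmorphB !rmorphM !rmorph_nat !rmorph_ultraW.
Qed.

Lemma rmorph_zonal s a d : g (zonal n s a d) = zonal n (g s) (g a) d.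
Proof.
case: d => [|d] /=; first by rewrite rmorph1.
by rewrite rmorphB !rmorphM !rmorph_nat !rmorph_ultraU.
Qed.
End UltrasphericalMorphism.

(** Polynomial functions of [n] variables as syntax, so that a single
    expression can be evaluated in every commutative ring and differentiated
    formally. [PNormSq] is the squared norm of the vector of variables. *)
Inductive pexp (n : nat) :=
  PVar of 'I_n | PNat of nat | PNormSq | PSub of pexp n & pexp n | PMul of pexp n & pexp n.
Arguments PNat {n}. Arguments PNormSq {n}.

Definition dotp (A : comNzRingType) n (x y : 'I_n -> A) : A :=
  \sum_(i < n) x i * y i.

Section PolynomialExpressions.
Variable n : nat.

Fixpoint peval (A : comNzRingType) (x : 'I_n -> A) (e : pexp n) : A :=
  match e with
  | PVar i => x i
  | PNat k => k%:R
  | PNormSq => dotp x x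
  | PSub e1 e2 => peval x e1 - peval x e2
  | PMul e1 e2 => peval x e1 * peval x e2
  end.

(** A sum [p + q] is encoded as [p - (0 - q)]. *)
Fixpoint pder (i : 'I_n) (e : pexp n) : pexp n :=
  match e with
  | PVar j => PNat (i == j)
  | PNat k => PNat 0
  | PNormSq => PMul (PNat 2) (PVar i)
  | PSub e1 e2 => PSub (pder i e1) (pder i e2)
  | PMul e1 e2 => PSub (PMul (pder i e1) e2) (PMul (PSub (PNat 0) e1) (pder i e2))
  end.

Variable A : comNzRingType.
Implicit Types x y : 'I_n -> A.

Definition pcst x : 'I_n -> {poly A} := fun j => (x j)%:P.
(** The line through [x] in the [i]-th direction, parametrized by the
    variable of [{poly A}]: partial derivatives of expressions become
    derivatives at [0] of univariate polynomials. *)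
Definition pline x (i : 'I_n) : 'I_n -> {poly A} :=
  fun j => (x j)%:P + (i == j)%:R * 'X.

Lemma peval_cst x e : peval (pcst x) e = (peval x e)%:P.
Proof.
elim: e => [i|k||e1 h1 e2 h2|e1 h1 e2 h2] //=; rewrite ?h1 ?h2.
- by rewrite rmorph_nat.
- by rewrite /dotp rmorph_sum; apply: eq_bigr => i _; rewrite rmorphM.
- by rewrite rmorphB.
- by rewrite rmorphM.
Qed.

Lemma horner_pline x i j : (pline x i j).[0] = x j.
Proof. by rewrite /pline hornerD hornerM hornerX mulr0 hornerC addr0. Qed.

Lemma deriv_pline x i j : (pline x i j)^`() = (i == j)%:R.
Proof. by rewrite /pline derivD derivC derivM derivX derivMn derivC mul0rn mul0r !add0r mulr1. Qed.

Lemma horner_dotp_pline x i : (dotp (pline x i) (pline x i)).[0] = dotp x x.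
Proof.
by rewrite /dotp horner_sum; apply: eq_bigr => j _; rewrite hornerM horner_pline.
Qed.

Lemma deriv_dotp_pline x i : (dotp (pline x i) (pline x i))^`().[0] = 2 * x i.
Proof.
rewrite /dotp raddf_sum horner_sum (bigD1 i) //= big1 ?addr0 => [|j ji].
  by rewrite derivM !deriv_pline eqxx hornerD !hornerM horner_pline !hornerE; ring.
by rewrite derivM !deriv_pline eq_sym (negPf ji) mul0r mulr0 addr0 horner0.
Qed.

Lemma horner_dotp_cst x y i : (dotp (pcst x) (pline y i)).[0] = dotp x y.
Proof.
by rewrite /dotp horner_sum; apply: eq_bigr => j _; rewrite hornerM horner_pline hornerC.
Qed.

Lemma deriv_dotp_cst x y i : (dotp (pcst x) (pline y i))^`() = (x i)%:P.
Proof.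
rewrite /dotp raddf_sum (bigD1 i) //= big1 ?addr0 => [|j ji].
  by rewrite derivM deriv_pline eqxx derivC mul0r add0r mulr1.
by rewrite derivM deriv_pline eq_sym (negPf ji) derivC mul0r mulr0 addr0.
Qed.

Lemma dotpC x y : dotp x y = dotp y x.
Proof. by apply: eq_bigr => i _; rewrite mulrC. Qed.

Lemma dotp_pcst x : dotp (pcst x) (pcst x) = (dotp x x)%:P.
Proof. by rewrite -[RHS](peval_cst x PNormSq). Qed.

Lemma peval_line x i e : (peval (pline x i) e).[0] = peval x e
  /\ (peval (pline x i) e)^`().[0] = peval x (pder i e).
Proof.
elim: e => [j|k||e1 [h1 h1'] e2 [h2 h2']|e1 [h1 h1'] e2 [h2 h2']] /=.
- by rewrite horner_pline deriv_pline; split => //; case: eqP => _; rewrite ?hornerE.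
- by rewrite -polyC_natr hornerC derivC horner0.
- by rewrite horner_dotp_pline deriv_dotp_pline.
- by rewrite derivB !hornerD !hornerN h1 h2 h1' h2'.
- by rewrite derivM !hornerD !hornerM h1 h2 h1' h2'; split => //; ring.
Qed.
End PolynomialExpressions.

(** * Positive definiteness of zonal polynomials *)

Section ZonalFeatures.
Variable n : nat.

Lemma horner_deriv_sum (A : comNzRingType) (I : finType) (F : I -> {poly A}) t :
  (\sum_i F i)^`().[t] = \sum_i (F i)^`().[t].
Proof. by rewrite raddf_sum horner_sum. Qed.

Lemma horner_ultraU (A : comNzRingType) (s a : {poly A}) t j :
  (ultraU n s a j).[t] = ultraU n s.[t] a.[t] j.
Proof. exact: (rmorph_ultraU n (horner_eval t)). Qed.

Lemma horner_ultraW (A : comNzRingType) (s a : {poly A}) t j :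
  (ultraW n s a j).[t] = ultraW n s.[t] a.[t] j.
Proof. exact: (rmorph_ultraW n (horner_eval t)). Qed.

Lemma horner_zonal (A : comNzRingType) (s a : {poly A}) t j :
  (zonal n s a j).[t] = zonal n s.[t] a.[t] j.
Proof. exact: (rmorph_zonal n (horner_eval t)). Qed.

Lemma deriv_ultraU (A : comNzRingType) (s a : {poly A}) j :
  (ultraU n s a j)^`() = n%:R * (j%:R * ultraW n s a j.-1 * s^`()
    - ('C(j, 2))%:R * ultraW n s a j.-2 * a^`()).
Proof.
apply: (@der_ultraU _ n (fun p q => p^`() = q)) => //.
- by move=> k; rewrite -polyC_natr derivC.
- by move=> x x' y y' <- <-; rewrite derivB.
- by move=> x x' y y' <- <-; rewrite derivM.
Qed.

Lemma deriv_zonal (A : comNzRingType) (s a : {poly A}) d :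
  (zonal n s a d)^`() = d%:R * ultraU n s a d.-1 * s^`()
    - ('C(d, 2))%:R * ultraU n s a d.-2 * a^`().
Proof.
apply: (@der_zonal _ n (fun p q => p^`() = q)) => //.
- by move=> k; rewrite -polyC_natr derivC.
- by move=> x x' y y' <- <-; rewrite derivB.
- by move=> x x' y y' <- <-; rewrite derivM.
Qed.

Lemma bin2E (A : comNzRingType) d : ('C(d.+1, 2))%:R * 2 = d.+1%:R * d%:R :> A.
Proof. by rewrite -!natrM muln2 bin2 halfK oddM /= andNb subn0. Qed.

(** If [h] is harmonic of degree [d + 1], then this is a multiple of the
    harmonic projection of [x_i h], because the Laplacian of [x_i h] is twice
    [h_i], and that of [|x| ^ 2 h_i] is [2 (2 d + n) h_i], for [h_i] the [i]-th
    partial derivative of [h]. *)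
Definition raising (d : nat) (i : 'I_n) (e : pexp n) : pexp n :=
  PSub (PMul (PNat (2 * d + n)) (PMul (PVar i) e)) (PMul PNormSq (pder i e)).

Variables (T : finType) (e : T -> pexp n) (c d : nat).
Hypothesis He : forall (A : comNzRingType) (x y : 'I_n -> A),
  \sum_t peval x (e t) * peval y (e t) =
  c%:R * zonal n (dotp x y) (dotp x x * dotp y y) d.+1.

(** Differentiate the hypothesis in the [i]-th coordinate of [y];
    the terms in [|x| ^ 2] cancel by [zonal_ultraU]. *)
Lemma raising_right (A : comNzRingType) (x y : 'I_n -> A) i :
  \sum_t peval x (e t) * peval y (raising d i (e t)) =
  c%:R * (y i * ultraU n (dotp x y) (dotp x x * dotp y y) d.+1
   - d.+1%:R * dotp y y * x i * ultraU n (dotp x y) (dotp x x * dotp y y) d).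
Proof.
have := congr1 (fun p => p^`().[0]) (He (pcst x) (pline y i)).
rewrite horner_deriv_sum.
under eq_bigr => t _.
  rewrite peval_cst derivM derivC mul0r add0r hornerM hornerC (peval_line _ _ _).2.
  over.
rewrite -[c%:R]polyC_natr derivM derivC mul0r add0r hornerM hornerC.
rewrite deriv_zonal deriv_dotp_cst derivM dotp_pcst derivC mul0r add0r.
rewrite hornerD hornerN !hornerM deriv_dotp_pline !hornerC -!polyC_natr !hornerC.
rewrite !horner_ultraU horner_dotp_cst hornerM horner_dotp_pline hornerC [d.+1.-1]/=.
set s := dotp x y; set a := dotp x x * dotp y y => h.
under eq_bigr => t _ do rewrite /= mulrBr mulrCA (mulrCA _ (dotp _ _)) [X in _ * X - _]mulrCA.
rewrite sumrB -!mulr_sumr h He -/s -/a.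
have hb := zonal_ultraU n s a d.
transitivity (c%:R * (y i * ((2 * d + n)%:R * zonal n s a d.+1)
  - dotp y y * (d.+1%:R * ultraU n s a d * x i)
  + dotp y y * ultraU n s a d.-1 * dotp x x * y i * ('C(d.+1, 2)%:R * 2))).
  by rewrite /=; ring.
rewrite hb bin2E natrM /a; ring.
Qed.

(** The same step in [x] produces the next zonal kernel, minus
    [|x| ^ 2] times the divergence of the vector found in [raising_right];
    [rel] expresses that this divergence is zero. *)
Lemma raising_both (A : comNzRingType) (x y : 'I_n -> A) :
  \sum_i \sum_t peval x (raising d i (e t)) * peval y (raising d i (e t)) =
  ((2 * d + n) * c)%:R * zonal n (dotp x y) (dotp x x * dotp y y) d.+2.
Proof.
set s := dotp x y; set a := dotp x x * dotp y y.
have h i : \sum_t peval x (pder i (e t)) * peval y (raising d i (e t)) =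
  c%:R * (n%:R * y i * (d.+1%:R * ultraW n s a d * y i
     - (d.+1 * d)%:R * ultraW n s a d.-1 * (dotp y y * x i))
    - d.+1%:R * dotp y y * (ultraU n s a d + n%:R * x i *
      (d%:R * ultraW n s a d.-1 * y i
       - (d * d.-1)%:R * ultraW n s a d.-2 * (dotp y y * x i)))).
  have := congr1 (fun p => p^`().[0]) (raising_right (pline x i) (pcst y) i).
  rewrite horner_deriv_sum.
  under eq_bigr => t _.
    rewrite peval_cst derivM derivC mulr0 addr0 hornerM hornerC (peval_line _ _ _).2.
    over.
  move=> ->; set S := dotp _ (pcst y); set Q := dotp _ _ * dotp _ _.
  have S0 : S.[0] = s by rewrite /S dotpC horner_dotp_cst dotpC.
  have S1 : S^`() = (y i)%:P by rewrite /S dotpC deriv_dotp_cst.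
  have Q0 : Q.[0] = a by rewrite /Q dotp_pcst hornerM hornerC horner_dotp_pline.
  have Q1 : Q^`().[0] = 2 * x i * dotp y y.
    by rewrite /Q dotp_pcst derivM derivC mulr0 addr0 hornerM hornerC deriv_dotp_pline.
  have U0 j : (ultraU n S Q j).[0] = ultraU n s a j by rewrite horner_ultraU S0 Q0.
  have U1 j : (ultraU n S Q j)^`().[0] = n%:R * (j%:R * ultraW n s a j.-1 * y i -
      'C(j, 2)%:R * ultraW n s a j.-2 * (2 * x i * dotp y y)).
    rewrite deriv_ultraU S1 -!polyC_natr hornerM hornerC hornerD hornerN.
    by rewrite !hornerM !hornerC !horner_ultraW Q1 S0 Q0.
  rewrite -[c%:R]polyC_natr -[d.+1%:R]polyC_natr dotp_pcst /pcst.
  move: (U0 d.+1) (U1 d.+1) (U0 d) (U1 d) (horner_pline x i i) (deriv_pline x i i).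
  rewrite eqxx.
  move: (ultraU n S Q d.+1) (ultraU n S Q d) (pline x i i).
  move=> u1 u0 l u10 u11 u00 u01 l0 l1.
  rewrite derivM derivC mul0r add0r hornerM hornerC derivB hornerD hornerN.
  rewrite !derivM !derivC !mul0r !add0r l1.
  rewrite !(hornerD, hornerM, hornerC) u11 u01 u00 l0.
  transitivity (c%:R * (n%:R * y i * (d.+1%:R * ultraW n s a d * y i
     - ('C(d.+1, 2)%:R * 2) * ultraW n s a d.-1 * (dotp y y * x i))
    - d.+1%:R * dotp y y * (ultraU n s a d + n%:R * x i *
      (d%:R * ultraW n s a d.-1 * y i
       - ('C(d, 2)%:R * 2) * ultraW n s a d.-2 * (dotp y y * x i))))).
    by rewrite [LHS]/=; ring.
  have b0 : ('C(d, 2)%:R * 2) = (d * d.-1)%:R :> A.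
    by case: (d) => [|k]; [rewrite bin0n mul0n mul0r|rewrite bin2E natrM].
  by rewrite b0 bin2E -[_ * d%:R]natrM.
have h2 i : \sum_t peval x (raising d i (e t)) * peval y (raising d i (e t)) =
  (2 * d + n)%:R * (c%:R * ((x i * y i) * ultraU n s a d.+1
   - d.+1%:R * dotp y y * (x i * x i) * ultraU n s a d))
  - dotp x x * (c%:R * (n%:R * (d.+1%:R * ultraW n s a d * (y i * y i)
     - (d.+1 * d)%:R * ultraW n s a d.-1 * dotp y y * (x i * y i))
    - d.+1%:R * dotp y y * (ultraU n s a d + n%:R *
      (d%:R * ultraW n s a d.-1 * (x i * y i)
       - (d * d.-1)%:R * ultraW n s a d.-2 * dotp y y * (x i * x i))))).
  under eq_bigr => t _ do rewrite [peval x _]/= mulrBl -!mulrA.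
  rewrite sumrB -!mulr_sumr (raising_right x y i) h -/s -/a; ring.
have sum4 P1 P2 P3 P4 : \sum_(i < n) (x i * y i * P1 + x i * x i * P2 + y i * y i * P3 + P4)
    = s * P1 + dotp x x * P2 + dotp y y * P3 + n%:R * P4.
  by rewrite !big_split /= -!mulr_suml sumr_const card_ord mulr_natl.
pose N1 := dotp x x; pose N2 := dotp y y.
pose P1 := c%:R * ((2 * d + n)%:R * ultraU n s a d.+1
  + 2 * N1 * N2 * n%:R * (d.+1 * d)%:R * ultraW n s a d.-1).
pose P2 := - c%:R * d.+1%:R * N2 * ((2 * d + n)%:R * ultraU n s a d
  + N1 * N2 * n%:R * (d * d.-1)%:R * ultraW n s a d.-2).
pose P3 := - N1 * c%:R * n%:R * d.+1%:R * ultraW n s a d.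
pose P4 := N1 * N2 * c%:R * d.+1%:R * ultraU n s a d.
transitivity (s * P1 + N1 * P2 + N2 * P3 + n%:R * P4).
  rewrite -sum4; apply: eq_bigr => i _; rewrite h2 -/N1 -/N2 /P1 /P2 /P3 /P4; ring.
have rel : n%:R * ultraU n s a d = n%:R * (ultraW n s a d
    - 2 * d%:R * s * ultraW n s a d.-1 + (d * d.-1)%:R * a * ultraW n s a d.-2).
  have e1 := ultraU_W n s a d.
  have e2 : d%:R * ultraU n s a d = d%:R * (n%:R * (s * ultraW n s a d.-1
     - d.-1%:R * a * ultraW n s a d.-2)) by case: (d) => [|k] //; rewrite !mul0r.
  transitivity ((d + n)%:R * ultraU n s a d - d%:R * ultraU n s a d).
    by rewrite natrD; ring.
  by rewrite e1 e2 natrM; ring.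
rewrite [n%:R * P4](_ : _ = N1 * N2 * c%:R * d.+1%:R * (n%:R * ultraU n s a d));
  last by rewrite /P4; ring.
have -> : zonal n s a d.+2 = s * ultraU n s a d.+1 - d.+1%:R * a * ultraU n s a d.
  by [].
rewrite rel (_ : a = N1 * N2) // /P1 /P2 /P3 !natrM; set u1 := ultraU n s _ d.+1; ring.
Qed.
End ZonalFeatures.

(** The quantification over all rings is what the induction needs:
    each step evaluates the previous identity on lines, that is over
    [{poly A}]. *)
Lemma zonal_features n d : (0 < n)%N ->
  exists (T : finType) (e : T -> pexp n) (c : nat), (0 < c)%N /\
  forall (A : comNzRingType) (x y : 'I_n -> A),
  \sum_t peval x (e t) * peval y (e t) =
  c%:R * zonal n (dotp x y) (dotp x x * dotp y y) d.
Proof.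
move=> n0; elim: d => [|[|d] [T [e [c [c0 He]]]]].
- exists unit, (fun=> PNat 1), 1%N; split => // A x y.
  by rewrite big_const card_unit /= addr0.
- exists 'I_n, (@PVar n), 1%N; split => // A x y.
  by rewrite /= mul0r mul0r subr0 mulr1 mul1r.
exists ('I_n * T)%type, (fun p => raising d p.1 (e p.2)), ((2 * d + n) * c)%N.
split; first by rewrite muln_gt0 c0 addn_gt0 n0 orbT.
move=> A x y; rewrite -(raising_both He) pair_big /=.
by apply: eq_bigr => -[].
Qed.

(** Positive definiteness as the existence of a finite Gram
    representation, which makes the stability by products immediate. *)
Definition psd_on_sphere (R : realType) n (k : R -> R) : Prop :=
  exists (T : finType) (phi : T -> 'rV[R]_n -> R),
  forall x y, on_sphere x -> on_sphere y ->
    \sum_t phi t x * phi t y = k (dot x y).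

Section PSD.
Variables (R : realType) (n : nat).
Implicit Types (k l : R -> R) (x y : 'rV[R]_n).

Lemma psd_zonal d : (0 < n)%N ->
  psd_on_sphere n (fun t : R => zonal n t 1 d).
Proof.
move=> n0; have [T [e [c [c0 He]]]] := zonal_features d n0.
exists T, (fun t x => (Num.sqrt c%:R)^-1 * peval (x 0) (e t)) => x y xS yS.
under eq_bigr => t _ do rewrite mulrACA.
rewrite -mulr_sumr -expr2 exprVn sqr_sqrtr ?ler0n // (He R (x 0) (y 0)).
rewrite (_ : dotp (x 0) (x 0) = 1) // (_ : dotp (y 0) (y 0) = 1) // mulr1.
by rewrite mulKf // pnatr_eq0 -lt0n.
Qed.

Lemma psd_ext k l : k =1 l -> psd_on_sphere n k -> psd_on_sphere n l.
Proof.
by move=> kl [T [phi H]]; exists T, phi => x y xS yS; rewrite H // kl.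
Qed.

Lemma psd_add k l : psd_on_sphere n k -> psd_on_sphere n l ->
  psd_on_sphere n (fun t => k t + l t).
Proof.
move=> [T [phi H]] [T' [phi' H']].
exists (T + T')%type, (fun s => match s with inl t => phi t | inr t => phi' t end).
by move=> x y xS yS; rewrite big_sumType /= H // H'.
Qed.

Lemma psd_mul k l : psd_on_sphere n k -> psd_on_sphere n l ->
  psd_on_sphere n (fun t => k t * l t).
Proof.
move=> [T [phi H]] [T' [phi' H']].
exists (T * T')%type, (fun s x => phi s.1 x * phi' s.2 x).
move=> x y xS yS; rewrite -H // -H' // mulr_suml -(pair_bigA _
  (fun t t' => (phi t x * phi' t' x) * (phi t y * phi' t' y))) /=.
apply: eq_bigr => t _; rewrite mulr_sumr; apply: eq_bigr => t' _.
by rewrite mulrACA.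
Qed.

Lemma psd_scale (c : R) k : 0 <= c -> psd_on_sphere n k ->
  psd_on_sphere n (fun t => c * k t).
Proof.
move=> c0 [T [phi H]]; exists T, (fun t x => Num.sqrt c * phi t x) => x y xS yS.
rewrite -H // mulr_sumr; apply: eq_bigr => t _.
by rewrite mulrACA -expr2 sqr_sqrtr.
Qed.

Lemma psd_const1 : psd_on_sphere n (fun=> 1 : R).
Proof. by exists unit, (fun=> fun=> 1) => x y _ _; rewrite big_const card_unit /= addr0 mulr1. Qed.

Lemma double_sum_sqr (I : finType) (a : I -> R) :
  \sum_i \sum_j a i * a j = (\sum_i a i) ^+ 2.
Proof.
by rewrite expr2 mulr_suml; apply: eq_bigr => i _; rewrite mulr_sumr.
Qed.

(** The hypothesis says that the vector
    [\sum_j w j * phi (x j)] has length zero. *)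
Lemma psd_annihilates N k (x : 'I_N -> 'rV[R]_n) (w : 'I_N -> R) y :
  psd_on_sphere n k -> (forall i, on_sphere (x i)) -> on_sphere y ->
  \sum_i \sum_j w i * w j * k (dot (x i) (x j)) = 0 ->
  \sum_j w j * k (dot y (x j)) = 0.
Proof.
move=> [T [phi H]] xS yS h.
have e : \sum_t (\sum_i w i * phi t (x i)) ^+ 2 = 0.
  rewrite -[RHS]h; under eq_bigr => t _ do rewrite -double_sum_sqr.
  rewrite exchange_big; apply: eq_bigr => i _; rewrite exchange_big.
  apply: eq_bigr => j _; rewrite -H // mulr_sumr; apply: eq_bigr => t _.
  by rewrite mulrACA.
have z t : \sum_i w i * phi t (x i) = 0.
  apply/eqP; rewrite -sqrf_eq0; apply/eqP; apply: (psumr_eq0P _ e) => //= s _.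
  exact: sqr_ge0.
under eq_bigr => j _ do rewrite -H // mulr_sumr.
rewrite exchange_big /= big1 // => t _.
under eq_bigr => j _ do rewrite mulrCA.
by rewrite -mulr_sumr z mulr0.
Qed.

(** Expand the squared length of
    [\sum_i w i * phi (x i) - \sum_i v i * phi (z i)]. *)
Lemma psd_energy_ge N M k (x : 'I_N -> 'rV[R]_n) (w : 'I_N -> R)
    (z : 'I_M -> 'rV[R]_n) (v : 'I_M -> R) (c : R) :
  psd_on_sphere n k -> (forall i, on_sphere (x i)) -> (forall i, on_sphere (z i)) ->
  \sum_i w i = 1 -> \sum_i v i = 1 ->
  (forall y, on_sphere y -> \sum_j v j * k (dot y (z j)) = c) ->
  c <= \sum_i \sum_j w i * w j * k (dot (x i) (x j)).
Proof.
move=> [T [phi H]] xS zS w1 v1 hc.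
pose a t := \sum_i w i * phi t (x i); pose b t := \sum_i v i * phi t (z i).
have gram I J (u : 'I_I -> 'rV[R]_n) (p : 'I_I -> R) (u' : 'I_J -> 'rV[R]_n) (p' : 'I_J -> R) :
    (forall i, on_sphere (u i)) -> (forall i, on_sphere (u' i)) ->
    \sum_t (\sum_i p i * phi t (u i)) * (\sum_j p' j * phi t (u' j)) =
    \sum_i p i * \sum_j p' j * k (dot (u i) (u' j)).
  move=> uS uS'; under eq_bigr => t _ do rewrite mulr_suml.
  rewrite exchange_big; apply: eq_bigr => i _ /=.
  under eq_bigr => t _ do rewrite mulr_sumr.
  rewrite exchange_big mulr_sumr; apply: eq_bigr => j _ /=.
  by rewrite -H // !mulr_sumr; apply: eq_bigr => t _; rewrite mulrACA -mulrA.
have : 0 <= \sum_t (a t - b t) ^+ 2 by apply: sumr_ge0 => t _; exact: sqr_ge0.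
have -> : \sum_t (a t - b t) ^+ 2 =
    \sum_t a t * a t - 2 * \sum_t a t * b t + \sum_t b t * b t.
  by rewrite mulr_sumr -sumrB -big_split; apply: eq_bigr => t _ /=; ring.
rewrite !gram //.
under [X in _ - 2 * X]eq_bigr => i _ do rewrite hc //.
under [X in _ + X]eq_bigr => i _ do rewrite hc //.
rewrite -!mulr_suml w1 v1 mul1r.
under [in X in _ -> _ <= X]eq_bigr => i _.
  under eq_bigr => j _ do rewrite -mulrA.
  rewrite -mulr_sumr; over.
move=> h; rewrite -subr_ge0; apply: le_trans h _.
by rewrite le_eqVlt; apply/orP; left; apply/eqP; ring.
Qed.
End PSD.

(** * Linear functionals and the Gegenbauer differential equation *)

Definition lin_functional (R : realFieldType) (M : {poly R} -> R) :=
  forall c p q, M (c *: p + q) = c * M p + M q.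

Section LinFunctional.
Variables (R : realFieldType) (M : {poly R} -> R).
Hypothesis ML : lin_functional M.

Lemma lin_functional0 : M 0 = 0.
Proof.
by have := ML 1 0 0; rewrite scaler0 addr0 mul1r -{1}[M 0]addr0 => /addrI.
Qed.

Lemma lin_functionalZ c p : M (c *: p) = c * M p.
Proof. by rewrite -[c *: p]addr0 ML lin_functional0 addr0. Qed.

Lemma lin_functionalD p q : M (p + q) = M p + M q.
Proof. by rewrite -[p in LHS]scale1r ML mul1r. Qed.

Lemma lin_functionalB p q : M (p - q) = M p - M q.
Proof. by rewrite -scaleN1r lin_functionalD lin_functionalZ mulN1r. Qed.

Lemma lin_functional_sum (I : finType) (c : I -> R) (p : I -> {poly R}) :
  M (\sum_i c i *: p i) = \sum_i c i * M (p i).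
Proof.
apply: (big_ind2 (fun a b => M a = b)) => [|p1 a1 p2 a2 <- <-|i _].
- exact: lin_functional0.
- exact: lin_functionalD.
- exact: lin_functionalZ.
Qed.
End LinFunctional.

Lemma poly_triangular_ind (F : fieldType) (P : {poly F} -> Prop) (p : nat -> {poly F}) d :
  P 0 -> (forall c q r, P q -> P r -> P (c *: q + r)) ->
  (forall i, (i < d)%N -> [/\ (size (p i) <= i.+1)%N, (p i)`_i != 0 & P (p i)]) ->
  forall q : {poly F}, (size q <= d)%N -> P q.
Proof.
move=> P0 PD; elim: d => [|d IH] hp q sq.
  by move: sq; rewrite leqn0 size_poly_eq0 => /eqP ->.
have [sp ld Pp] := hp d (ltnSn d).
have -> : q = (q`_d / (p d)`_d) *: p d + (q - (q`_d / (p d)`_d) *: p d).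
  by rewrite addrC subrK.
apply: PD => //; apply: IH => [i id|]; first exact: hp (ltnW _).
apply/leq_sizeP => j; rewrite leq_eqVlt => /orP[/eqP <-|dj].
  by rewrite coefB coefZ divfK // subrr.
have qj : q`_j = 0 by apply/nth_default/(leq_trans sq).
have pj : (p d)`_j = 0 by apply/nth_default/(leq_trans sp).
by rewrite coefB coefZ qj pj mulr0 subr0.
Qed.

Section ZonalPolynomial.
Variables (R : realType) (n : nat).
Hypothesis n2 : (2 <= n)%N.

Definition zonalP d : {poly R} := zonal n 'X 1 d.

Lemma horner_zonalP d t : (zonalP d).[t] = zonal n t 1 d.
Proof. by rewrite /zonalP horner_zonal hornerX hornerC. Qed.

Definition pos_lead (p : {poly R}) j := (size p <= j.+1)%N /\ 0 < p`_j.

Lemma pos_lead_rec (c : R) (p q : {poly R}) j : 0 < c -> pos_lead p j -> (size q <= j.+1)%N ->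
  pos_lead (c *: ('X * p) - q) j.+1.
Proof.
move=> c0 [sp lp] sq; split.
  rewrite (leq_trans (size_polyD _ _)) // geq_max size_polyN (leq_trans sq) // andbT.
  rewrite (leq_trans (size_scale_leq _ _)) // mulrC.
  by rewrite (leq_trans (size_polyMleq _ _)) // size_polyX addn2.
by rewrite coefB coefZ coefXM /= [X in _ - X]nth_default // subr0 mulr_gt0.
Qed.

Lemma natr_mulZ k (p : {poly R}) : k%:R * p = k%:R *: p.
Proof. by rewrite mulr_natl scaler_nat. Qed.

Lemma size_scaled_le (p : {poly R}) (k : nat) j :
  (size p <= j)%N -> (size ((k%:R * 1 * p)%R : {poly R}) <= j)%N.
Proof.
move=> h; rewrite mulr1 natr_mulZ.
by rewrite (leq_trans (size_scale_leq _ _)).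
Qed.

Lemma pos_lead_ultraW j : pos_lead (ultraW n 'X 1 j) j.
Proof.
elim/ltn_ind: j => -[|j] IH; first by split; rewrite ?size_poly1 ?coefC.
rewrite ultraWS -mulrA natr_mulZ; apply: pos_lead_rec.
- by rewrite ltr0n addn_gt0 addn_gt0 orbT.
- exact: IH.
apply: size_scaled_le => //; case: j IH => [|j] IH //=.
  by rewrite size_poly1.
by rewrite (leq_trans (IH _ _).1).
Qed.

Lemma pos_lead_ultraU j : pos_lead (ultraU n 'X 1 j) j.
Proof.
case: j => [|j]; first by split; rewrite ?size_poly1 ?coefC.
rewrite /= mulrBr natr_mulZ; apply: pos_lead_rec.
- by rewrite ltr0n (ltn_trans _ n2).
- exact: pos_lead_ultraW.
rewrite natr_mulZ (leq_trans (size_scale_leq _ _)) //.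
apply: size_scaled_le => //; case: j => [|j] /=; first by rewrite size_poly1.
by rewrite (leq_trans (pos_lead_ultraW _).1).
Qed.

Lemma pos_lead_zonalP d : pos_lead (zonalP d) d.
Proof.
case: d => [|d]; first by split; rewrite ?size_poly1 ?coefC.
rewrite /zonalP /= -[X in pos_lead (X - _)]scale1r; apply: pos_lead_rec => //.
  exact: pos_lead_ultraU.
apply: size_scaled_le => //; case: d => [|d] /=; first by rewrite size_poly1.
by rewrite (leq_trans (pos_lead_ultraU _).1).
Qed.

Lemma ultraU1_gt0 j : 0 < ultraU n 1 1 j :> R.
Proof.
elim: j => [|j IH]; first exact: ltr01.
have := ultraU_W n (1 : R) 1 j; rewrite /= !mulr1 mul1r => <-.
by rewrite mulr_gt0 // ltr0n addn_gt0 (ltn_trans _ n2) ?orbT.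
Qed.

Lemma zonal1_gt0 d : 0 < zonal n 1 1 d :> R.
Proof.
case: d => [|d]; first exact: ltr01.
have h : ultraU n (1 : R) 1 d = (d.-1 + n)%:R * ultraU n 1 1 d.-1 - (d == 0)%:R * (n%:R - 1).
  case: d => [|d] /=; first by rewrite mulr1 mul1r add0n; ring.
  by rewrite ultraU_W mul0r subr0 /= !mulr1 mul1r.
rewrite /= mul1r mulr1 h.
have -> : (d.-1 + n)%:R * ultraU n 1 1 d.-1 - (d == 0)%:R * (n%:R - 1)
   - d%:R * ultraU n 1 1 d.-1 = (if d == 0 then 1 else (n.-1)%:R * ultraU n 1 1 d.-1) :> R.
  case: d {h} => [|d] /=; first by rewrite add0n; ring.
  by case: n n2 => [|k] //= _; rewrite !natrD -!(addn1 d) -(addn1 k) !natrD; ring.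
case: eqP => _ //; rewrite mulr_gt0 ?ultraU1_gt0 // ltr0n.
by case: n n2 => [|[|k]].
Qed.

Lemma zonal_parity (A : comNzRingType) (s a : A) d :
  zonal n (- s) a d = (-1) ^+ d * zonal n s a d.
Proof.
have hW j : ultraW n (- s) a j = (-1) ^+ j * ultraW n s a j.
  elim/ltn_ind: j => -[|j] IH; first by rewrite mulr1.
  rewrite !ultraWS IH //; case: j IH => [|j] IH; first by rewrite mul0n; ring.
  by rewrite IH // ?(ltnW _) // !exprS /=; ring.
have hU j : ultraU n (- s) a j = (-1) ^+ j * ultraU n s a j.
  case: j => [|j] /=; first by rewrite mulr1.
  by rewrite !hW; case: j => [|j]; rewrite !exprS /=; ring.
case: d => [|d] /=; first by rewrite mulr1.
by rewrite !hU; case: d => [|d]; rewrite !exprS /=; ring.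
Qed.

(** The Gegenbauer operator. It is symmetric for the weight
    [(1 - t ^ 2) ^ ((n - 3) / 2)], and the zonal polynomials are eigenvectors
    for distinct eigenvalues. *)
Definition gegop (q : {poly R}) : {poly R} :=
  (1 - 'X ^+ 2) * q^`()^`() - n.-1%:R * 'X * q^`().

Lemma gegop_zonalP d : gegop (zonalP d) = - ((d * (d + n - 2))%N%:R *: zonalP d).
Proof.
rewrite /gegop /zonalP deriv_zonal derivX derivC mulr0 subr0 mulr1.
have dnat k (p : {poly R}) : (k%:R * p)^`() = k%:R * p^`().
  by rewrite natr_mulZ derivZ natr_mulZ.
rewrite dnat deriv_ultraU derivX derivC mulr0 subr0 mulr1.
case: d => [|[|d]].
- by rewrite mul0n scale0r oppr0; ring.
- by rewrite -natr_mulZ mul1n subSS subn1 /=; ring.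
rewrite [d.+2.-1]/= [d.+1.-1]/= [zonal _ _ _ _]/= -/(ultraU n 'X 1 d.+1).
have hU := ultraU_W n ('X : {poly R}) 1 d.
rewrite -scalerN -natr_mulZ.
rewrite (_ : d.+2 + n - 2 = d + n)%N; last by rewrite !addSn subn2.
transitivity (d.+2%:R * ((1 - 'X^2) * (n%:R * (d.+1%:R * ultraW n 'X 1 d)) -
  n.-1%:R * 'X * ultraU n 'X 1 d.+1) : {poly R}); first by ring.
rewrite natrM -[RHS]mulrA; congr (_ * _).
rewrite [RHS](_ : _ = - (d + n)%:R * 'X * ultraU n 'X 1 d.+1
  + d.+1%:R * ((d + n)%:R * ultraU n 'X 1 d)); last by rewrite /=; ring.
rewrite hU.
have -> : n.-1%:R = n%:R - 1 :> {poly R} by rewrite -[in RHS](prednK (ltnW n2)) -addn1 natrD addrK.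
by rewrite /= natrD; ring.
Qed.

Variable L : {poly R} -> R.
Hypothesis LD : lin_functional L.
Hypothesis Lstein : forall r, L ((1 - 'X ^+ 2) * r^`() - n.-1%:R * 'X * r) = 0.

(** The hypothesis [Lstein] makes [gegop] symmetric for [L], so
    that eigenvectors of distinct eigenvalues are orthogonal; those of degree
    below [d] span the polynomials of degree below [d]. *)
Lemma zonalP_orthogonal d (q : {poly R}) : (size q <= d)%N -> L (zonalP d * q) = 0.
Proof.
have LZ := lin_functionalZ LD.
apply: (@poly_triangular_ind _ (fun q => L (zonalP d * q) = 0) zonalP).
- by rewrite mulr0 (lin_functional0 LD).
- by move=> c p r hp hr; rewrite mulrDr -scalerAr LD hp hr mulr0 addr0.
move=> i id; have [s l] := pos_lead_zonalP i; split => //; first by rewrite gt_eqF.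
have sym p r : L (p * gegop r) = L (r * gegop p).
  have := Lstein (p * r^`() - r * p^`()).
  have -> : (1 - 'X^2) * (p * r^`() - r * p^`())^`() -
      n.-1%:R * 'X * (p * r^`() - r * p^`()) = (-1) *: (r * gegop p) + p * gegop r.
    by rewrite derivB !derivM /gegop scaleN1r; ring.
  by rewrite LD mulN1r addrC => /eqP; rewrite subr_eq0 => /eqP.
have := sym (zonalP d) (zonalP i).
rewrite !gegop_zonalP -!scaleNr -!scalerAr !LZ [zonalP i * _]mulrC => /eqP.
rewrite -subr_eq0 -mulrBl mulf_eq0 => /orP[|/eqP //].
rewrite opprK addrC subr_eq0 eqr_nat => /eqP h; exfalso.
have : (i * (i + n - 2) < d * (d + n - 2))%N.
  rewrite -!addnBA //; apply: (@leq_ltn_trans (i * (d + (n - 2)))%N).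
    by rewrite leq_mul2l leq_add2r (ltnW id) orbT.
  by rewrite ltn_mul2r id andbT addn_gt0 (leq_ltn_trans _ id).
by rewrite h ltnn.
Qed.
End ZonalPolynomial.

(** * Integration against the Gegenbauer weight *)

Section GegenbauerWeight.
Variables (R : realType) (n : nat).
Hypothesis n2 : (2 <= n)%N.
Notation mu := (@lebesgue_measure R).
Notation D := (`[(-1 : R), 1]%classic).
Notation wgt := (@gegenbauer_weight R n).

Lemma sqr_lt1_itv (t : R) : t \in `](-1), 1[%R -> 0 < 1 - t ^+ 2.
Proof. by rewrite in_itv /= => /andP[t1 t2]; nra. Qed.

Lemma gegenbauer_weight_sqrt (t : R) : t \in `](-1), 1[%R ->
  wgt t = Num.sqrt (1 - t ^+ 2) ^+ n.-1 / (1 - t ^+ 2).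
Proof.
move=> /sqr_lt1_itv h; rewrite /gegenbauer_weight.
have -> : (n%:R - 3%:R) / 2%:R = 2^-1 * n.-1%:R - 1 :> R.
  by rewrite -(prednK (ltnW n2)) /= -addn1 natrD; field.
rewrite powRB; last by rewrite (gt_eqF h) implybT.
by rewrite powRrM powR12_sqrt ?ltW // powR_mulrn ?sqrtr_ge0 // powRr1 // ltW.
Qed.

Lemma gegenbauer_weight_ge0 t : 0 <= wgt t.
Proof. exact: powR_ge0. Qed.

Lemma gegenbauer_weight_gt0 t : t \in `](-1), 1[%R -> 0 < wgt t.
Proof. by move=> /sqr_lt1_itv; exact: powR_gt0. Qed.

Lemma measurable_gegenbauer_weight : measurable_fun setT wgt.
Proof.
have -> : wgt = (@powR R)^~ ((n%:R - 3%:R) / 2%:R) \o (fun t => 1 - t ^+ 2) by [].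
apply: measurableT_comp; first exact: measurable_powR.
by apply: measurable_funB => //; apply: measurable_funX => //.
Qed.

Lemma continuous_gegenbauer_weight (t : R) : t \in `](-1), 1[%R ->
  {for t, continuous wgt}.
Proof.
move=> /sqr_lt1_itv h.
have -> : wgt = (@powR R)^~ ((n%:R - 3%:R) / 2%:R) \o horner (1 - 'X ^+ 2).
  by apply/funext => u; rewrite /= !hornerE.
apply: continuous_comp; first exact: continuous_horner.
apply: differentiable_continuous; apply/derivable1_diffP.
have hh : 0 < (1 - 'X ^+ 2).[t] by rewrite !hornerE.
by case: (is_derive1_powR ((n%:R - 3%:R) / 2%:R) hh).
Qed.

(** The weight is bounded by [1] if [n >= 3]. For
    [n = 2] it is the derivative of [asin], whose increments are at most [pi]. *)
Lemma integrable_gegenbauer_weight : mu.-integrable D (EFin \o wgt).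
Proof.
have mw A : measurable_fun A wgt by apply: measurable_funTS; exact: measurable_gegenbauer_weight.
have [n3|] := leqP 3 n.
  apply: measurable_bounded_integrable => //.
    by rewrite /= lebesgue_measure_itv /= lte_fin gtrN // -EFinD ltry.
  exact: mw.
  exists 1; split => // x x1 t /=; rewrite in_itv /= => /andP[t1 t2].
  rewrite ger0_norm ?gegenbauer_weight_ge0 // (le_trans _ (ltW x1)) //.
  rewrite /gegenbauer_weight -[leRHS](congr1 (@^~ ((n%:R - 3%:R) / 2%:R)) (@powR1 R)).
  apply: ge0_ler_powR; rewrite ?nnegrE ?divr_ge0 ?subr_ge0 ?ler_nat //.
  - by nra.
  - by rewrite gerBl sqr_ge0.
rewrite ltnS => n2'; have n_eq : n = 2%N by apply/eqP; rewrite eqn_leq n2' n2.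
apply/integrableP; split; first by apply/measurable_EFinP; exact: mw.
under eq_integral do rewrite /= ger0_norm ?gegenbauer_weight_ge0 //.
rewrite integral_itv_bndoo; last by apply/measurable_EFinP; exact: mw.
(* k.+2 ensures 0 < b k *)
pose b k : R := 1 - k.+2%:R^-1.
pose F k : set R := `[- b k, b k]%classic.
have b0 k : 0 < b k by rewrite subr_gt0 invf_lt1 ?ltr0n // ltr1n.
have b1 k : b k < 1 by rewrite gtrBl invr_gt0 ltr0n.
have -> : `](-1 : R), 1[%classic = \bigcup_k F k.
  apply/seteqP; split => [t /=|t [k _]]; rewrite /F /= !in_itv /=; last first.
    by move=> /andP[t1 t2]; rewrite (lt_le_trans _ t1) ?(le_lt_trans t2) // ltrN2.
  rewrite -ltr_norml => /ltr_add_invr[k hk]; exists k => //.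
  rewrite /F /= in_itv /= -ler_norml /b lerBrDr (le_trans _ (ltW hk)) // lerD2l.
  by rewrite lef_pV2 ?posrE // ler_nat.
have FE k : (\int[mu]_(t in F k) (wgt t)%:E = (asin (b k) - asin (- b k))%:E)%E.
  rewrite EFinB; apply: continuous_FTC2.
  - by rewrite gtrN.
  - apply: continuous_in_subspaceT => t; rewrite inE /= in_itv /= => /andP[t1 t2].
    apply: continuous_gegenbauer_weight; rewrite in_itv /=.
    by rewrite (lt_le_trans _ t1) ?(le_lt_trans t2) // ltrN2.
  - split.
    + move=> t; rewrite in_itv /= => /andP[t1 t2].
      have h : -1 < t < 1 by rewrite (lt_trans _ t1) ?(lt_trans t2) // ltrN2.
      by case: (is_derive1_asin h).
    + apply: cvg_at_right_filter; apply: continuous_asin.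
      by rewrite ltrN2 b1 (lt_trans _ ltr01) // oppr_lt0.
    + apply: cvg_at_left_filter; apply: continuous_asin.
      by rewrite b1 (lt_trans _ (b0 k)) // oppr_lt0.
  - move=> t; rewrite in_itv /= => /andP[t1 t2].
    have h : -1 < t < 1 by rewrite (lt_trans _ t1) ?(lt_trans t2) // ltrN2.
    have ht : t \in `](-1), 1[%R by rewrite in_itv.
    rewrite derive1E (@derive_val _ _ _ _ _ _ _ (is_derive1_asin h)) gegenbauer_weight_sqrt // n_eq expr1.
    have s0 := sqr_lt1_itv ht; rewrite -{3}(sqr_sqrtr (ltW s0)).
    by rewrite expr2 invfM mulrA divff ?mul1r // gt_eqF // sqrtr_gt0.
have cv : (\int[mu]_(t in F k) (wgt t)%:E @[k --> \oo] --> \int[mu]_(t in \bigcup_k F k) (wgt t)%:E)%E.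
  apply: ge0_nondecreasing_set_cvg_integral => //.
  - apply/nondecreasing_seqP => k; rewrite subsetEset /F => t /=.
    rewrite !in_itv /= -!ler_norml => /le_trans; apply.
    by rewrite lerD2l lerN2 lef_pV2 ?posrE // ler_nat.
  - by move=> k; exact: measurable_itv.
  - by move=> k; apply/measurable_EFinP; exact: mw.
  - by move=> k x _; rewrite lee_fin gegenbauer_weight_ge0.
rewrite -(cvg_lim _ cv) // (@le_lt_trans _ _ pi%:E) // ?ltry //.
apply: lime_le; first by apply/cvg_ex; eexists; exact: cv.
apply: nearW => k; rewrite FE lee_fin.
have hb : -1 <= b k <= 1 by rewrite (ltW (b1 k)) (le_trans _ (ltW (b0 k))) // oppr_le0.
have hb' : -1 <= - b k <= 1 by rewrite lerN2 (ltW (b1 k)) (le_trans _ (@ler01 R)) // oppr_le0 ltW.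
by have := asin_lepi2 hb; have := asin_geNpi2 hb'; lra.
Qed.
End GegenbauerWeight.

Section GegenbauerFunctional.
Variables (R : realType) (n : nat).
Hypothesis n2 : (2 <= n)%N.
Notation mu := (@lebesgue_measure R).
Notation D := (`[(-1 : R), 1]%classic).
Notation wgt := (@gegenbauer_weight R n).

Definition gegen_int (p : {poly R}) : R := (\int[mu]_(t in D) (p.[t] * wgt t))%R.

Lemma integrable_poly_weight (p : {poly R}) :
  mu.-integrable D (EFin \o (fun t => p.[t] * wgt t)).
Proof.
have -> : EFin \o (fun t => p.[t] * wgt t) = ((EFin \o wgt) \* (EFin \o horner p))%E.
  by apply/funext => t /=; rewrite mulrC EFinM.
apply: integrableMl => //.
- exact: integrable_gegenbauer_weight.
- by apply: measurable_funTS; apply: continuous_measurable_fun; exact: continuous_horner.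
have cD : compact (horner p @` D).
  apply: continuous_compact; last exact: segment_compact.
  by apply: continuous_subspaceT; exact: continuous_horner.
have [M [_ mrt]] := compact_bounded cD.
by exists M; split; rewrite ?num_real // => y My t Dt; apply: mrt => //; exists t.
Qed.

Lemma gegen_int_integral (p q : {poly R}) :
  (\int[mu]_(t in D) (p.[t] * q.[t] * wgt t)%:E = (gegen_int (p * q))%:E)%E.
Proof.
rewrite /gegen_int /Rintegral fineK.
  by apply: eq_integral => t _; rewrite hornerM.
exact: (integrable_fin_num _ (integrable_poly_weight _)).
Qed.

Lemma gegen_int_linear : lin_functional gegen_int.
Proof.
move=> c p q.
rewrite /gegen_int -RintegralZl //; last exact: integrable_poly_weight.
rewrite -RintegralD //; last exact: integrable_poly_weight.
  by apply: eq_Rintegral => t _; rewrite hornerD hornerZ mulrDl mulrA.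
have := integrable_poly_weight (c *: p); congr (_.-integrable _ _).
by apply/funext => t /=; rewrite hornerZ mulrA.
Qed.

Lemma poly_eq0_itv (p : {poly R}) : (forall t : R, t \in `](-1), 1[%R -> p.[t] = 0) -> p = 0.
Proof.
move=> h; apply: (@roots_geq_poly_eq0 _ p [seq k.+2%:R^-1 | k <- iota 0 (size p)]).
- apply/allP => x /mapP[k _ ->]; apply/rootP/h.
  rewrite in_itv /= invf_lt1 ?ltr0n // ltr1n andbT.
  by rewrite (@lt_trans _ _ 0) ?invr_gt0 ?ltr0n // oppr_lt0.
- rewrite map_inj_uniq ?iota_uniq // => i j /invr_inj /eqP.
  by rewrite eqr_nat => /eqP [].
- by rewrite size_map size_iota.
Qed.

Notation prim p x := ((\int[mu]_(t in `[(-1 : R), x]) (p.[t] * wgt t))%R).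

Lemma derive_prim (p : {poly R}) (t : R) : t \in `](-1), 1[%R ->
  is_derive t (1 : R) (fun x => prim p x) (p.[t] * wgt t).
Proof.
move=> ht; have := ht; rewrite in_itv /= => /andP[t1 t2].
have ct : {for t, continuous (fun t : R => p.[t] * wgt t)}.
  apply: cvgM; first exact: continuous_horner.
  exact: (continuous_gegenbauer_weight ht).
have [d1 d2] := continuous_FTC1_closed t2 (integrable_poly_weight p) t1 ct.
by apply: DeriveDef; [exact: d1|rewrite -derive1E; exact: d2].
Qed.

(** If the integral were zero, then the primitive of the integrand
    would vanish identically, and so would its derivative, the integrand
    itself. *)
Lemma gegen_int_gt0 (p : {poly R}) : p != 0 ->
  (forall t : R, t \in `[(-1), 1]%R -> 0 <= p.[t]) -> 0 < gegen_int p.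
Proof.
move=> p0 pp.
have g0 t : D t -> 0 <= p.[t] * wgt t.
  by move=> Dt; rewrite mulr_ge0 ?pp ?gegenbauer_weight_ge0.
have L0 : 0 <= gegen_int p by apply: Rintegral_ge0.
rewrite lt_neqAle L0 andbT eq_sym; apply: contra p0 => /eqP Lz.
apply/eqP/poly_eq0_itv => t ht; have := ht; rewrite in_itv /= => /andP[t1 t2].
have prim0 (x : R) : x \in `](-1), 1[%R -> prim p x = 0.
  rewrite in_itv /= => /andP[x1 x2]; apply/eqP; rewrite eq_le; apply/andP; split.
    rewrite -Lz /gegen_int /Rintegral fine_le //.
    - apply: (integrable_fin_num _ (integrableS _ _ _ (integrable_poly_weight p))) => //.
      by apply: subset_itvl; rewrite bnd_simp ltW.
    - exact: (integrable_fin_num _ (integrable_poly_weight p)).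
    - apply: ge0_subset_integral => //.
      + exact: (measurable_int _ (integrable_poly_weight p)).
      + by apply: subset_itvl; rewrite bnd_simp ltW.
  apply: Rintegral_ge0 => u /=; rewrite in_itv /= => /andP[u1 u2]; apply: g0.
  by rewrite /= in_itv /= u1 (le_trans u2) // ltW.
have d0 : is_derive t (1 : R) (fun x => prim p x) 0.
  apply: (@near_eq_is_derive _ _ _ (fun=> 0)) => //.
  near=> x; apply/esym/prim0.
  by near: x; exact: near_in_itvoo.
have [_ e1] := derive_prim p ht; have [_ e2] := d0.
move: e1; rewrite e2 => /esym/eqP; rewrite mulf_eq0 => /orP[/eqP //|].
by rewrite gt_eqF // gegenbauer_weight_gt0.
Unshelve. all: by end_near. Qed.

(** The integrand is the derivative of
    [sqrt (1 - t ^ 2) ^ (n - 1) * r], which vanishes at both ends. It may be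
    unbounded (for [n = 2]), so the mean value theorem is applied to the
    difference of this function and the integral up to [t]: both are continuous
    on the closed interval. *)
Lemma gegen_int_stein (r : {poly R}) :
  gegen_int ((1 - 'X ^+ 2) * r^`() - n.-1%:R * 'X * r) = 0.
Proof.
set q := _ - _.
pose F (t : R) : R := Num.sqrt ((1 - 'X ^+ 2).[t]) ^+ n.-1 * r.[t].
have dF (t : R) : t \in `](-1), 1[%R -> is_derive t (1 : R) F (q.[t] * wgt t).
  move=> ht; have h := sqr_lt1_itv ht.
  have hh : 0 < (1 - 'X ^+ 2).[t] by rewrite !hornerE.
  pose S := Num.sqrt \o horner (1 - 'X ^+ 2 : {poly R}).
  have dS : is_derive t (1:R) S ((2 * Num.sqrt (1 - 'X ^+ 2).[t])^-1 * (1 - 'X ^+ 2)^`().[t]).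
    by apply: is_derive1_comp; first exact: is_derive1_sqrt.
  have -> : F = S ^+ n.-1 * horner r by apply/funext => u; rewrite /F /S fctE exprfctE.
  have := is_deriveM (is_deriveX n.-1 dS) (is_derive_poly r t).
  move=> h1; apply: (trigger_derive h1).
  rewrite gegenbauer_weight_sqrt // exprfctE /S /= derivB derivC derivXn.
  rewrite /q !hornerE.
  set u := Num.sqrt (1 - t ^+ 2).
  have u0 : u != 0 by rewrite gt_eqF // sqrtr_gt0.
  have uu : 1 - t ^+ 2 = u ^+ 2 by rewrite sqr_sqrtr // ltW.
  have -> : (n.-1%:R : {poly R}).[t] = n.-1%:R by rewrite -polyC_natr hornerC.
  change (u ^+ n.-1 * r^`().[t] + r.[t] * ((n.-1%:R * u ^+ n.-2) * ((2 * u)^-1 * - (t + t)))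
    = (((1 - t ^+ 2) * r^`().[t] - n.-1%:R * t * r.[t]) * u ^+ n.-1) / (1 - t ^+ 2)).
  move: u0 uu; move: u => u u0 uu; rewrite uu.
  have [k ->] : exists k, n = k.+2 by exists (n - 2)%N; rewrite -addn2 subnK.
  by rewrite /= [u ^+ k.+1]exprS; field.
have cF : continuous F.
  move=> t; apply: cvgM; last exact: continuous_horner.
  apply: (@continuous_comp _ _ _ (Num.sqrt \o horner (1 - 'X ^+ 2)) (fun x => x ^+ n.-1)).
    apply: continuous_comp; [exact: continuous_horner|exact: sqrt_continuous].
  exact: exprn_continuous.
pose H x := prim q x - F x.
have cH : {within `[(-1 : R), 1], continuous H}.
  move=> t; apply: cvgB.
    apply: (@parameterized_integral_continuous R (-1) 1 (fun t => q.[t] * wgt t)) => //.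
    exact: integrable_poly_weight.
  by apply: continuous_subspaceT.
have lt11 : -1 < 1 :> R by rewrite (lt_trans _ ltr01) // oppr_lt0.
have dH (x : R) : x \in `](-1), 1[%R -> is_derive x (1 : R) H 0.
  move=> hx; rewrite -(subrr (q.[x] * wgt x)); apply: is_deriveB.
    exact: derive_prim.
  exact: dF.
have [c _] := MVT lt11 dH cH.
rewrite mul0r /H set_itv1 Rintegral_set1 /F !hornerE.
rewrite sqrrN !expr1n subrr sqrtr0 expr0n.
have -> : (n.-1 == 0)%N = false by move: n2; case: (n) => [|[|k]].
by rewrite !mul0r !oppr0 !addr0.
Qed.
End GegenbauerFunctional.

Section GegenbauerIsZonal.
Variables (R : realType) (n : nat).
Hypothesis n2 : (2 <= n)%N.
Notation L := (@gegen_int R n).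
Notation Z := (@zonalP R n).

Lemma gegen_int_zonalP d (q : {poly R}) : (size q <= d)%N -> L (Z d * q) = 0.
Proof.
apply: zonalP_orthogonal => //; first exact: gegen_int_linear.
exact: gegen_int_stein.
Qed.

Lemma horner1_zonalP_gt0 d : 0 < (Z d).[1].
Proof. by rewrite horner_zonalP zonal1_gt0. Qed.

Lemma size_zonalP d : size (Z d) = d.+1.
Proof.
have [s l] := @pos_lead_zonalP R n n2 d.
apply/eqP; rewrite eqn_leq s ltnNge; apply/negP => h.
by move: l; rewrite nth_default // ltxx.
Qed.

Lemma is_gegenbauer_zonal d : is_gegenbauer n d ((Z d).[1]^-1 *: Z d).
Proof.
have z0 : (Z d).[1] != 0 by rewrite gt_eqF ?horner1_zonalP_gt0.
split.
- by rewrite size_scale ?invr_eq0 // size_zonalP.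
- move=> q sq; rewrite gegen_int_integral // -scalerAl -[_ *: _]addr0.
  rewrite gegen_int_linear // gegen_int_zonalP //.
  by rewrite (lin_functional0 (gegen_int_linear n2)) mulr0 addr0.
- by rewrite hornerZ mulVf.
Qed.

(** Uniqueness: if [p] is another solution and [q] is the
    combination of [p] and [zonalP d] without term of degree [d], then [q] is
    orthogonal to itself. *)
Lemma gegenbauer_zonal d : gegenbauer R n d = (Z d).[1]^-1 *: Z d.
Proof.
have z0 : (Z d).[1] != 0 by rewrite gt_eqF ?horner1_zonalP_gt0.
apply: xget_unique; first exact: is_gegenbauer_zonal.
move=> p [sp op p1].
have lz : (Z d)`_d != 0 by rewrite gt_eqF //; have [_] := @pos_lead_zonalP R n n2 d.
pose c := p`_d / (Z d)`_d; pose q := p - c *: Z d.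
have sq : (size q <= d)%N.
  apply/leq_sizeP => j; rewrite leq_eqVlt => /orP[/eqP <-|dj].
    by rewrite coefB coefZ divfK // subrr.
  by rewrite coefB coefZ !nth_default ?size_zonalP ?sp // mulr0 subr0.
have pq : L (p * q) = 0.
  by have := op q sq; rewrite gegen_int_integral // => -[].
have qq : L (q * q) = 0.
  have -> : q * q = (- c) *: (Z d * q) + p * q.
    by rewrite {1}/q mulrBl scaleNr scalerAl addrC.
  by rewrite gegen_int_linear // gegen_int_zonalP // pq mulr0 addr0.
have q0 : q = 0.
  apply/eqP; apply/negPn/negP => qn0.
  suff : 0 < L (q * q) by rewrite qq ltxx.
  apply: gegen_int_gt0 => //; first by rewrite mulf_neq0.
  by move=> t _; rewrite hornerM -expr2 sqr_ge0.
have pE : p = c *: Z d by apply/eqP; rewrite -subr_eq0; apply/eqP.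
have cz : c * (Z d).[1] = 1 by rewrite -hornerZ -pE.
by rewrite pE; congr (_ *: _); rewrite -[LHS](mulfK z0) cz mul1r.
Qed.
End GegenbauerIsZonal.

(** * Prefix products of the nodes of a positive discrete functional *)

Definition monic_deg (R : realFieldType) (p : {poly R}) j := p \is monic /\ size p = j.+1.

Lemma monic_deg_subr (R : realFieldType) (p q : {poly R}) j :
  monic_deg p j -> monic_deg q j -> (size (p - q)%R <= j)%N.
Proof.
move=> [/monicP mp sp] [/monicP mq sq]; apply/leq_sizeP => i; rewrite leq_eqVlt.
case/orP => [/eqP <-|ji]; rewrite coefB.
  by move: mp mq; rewrite /lead_coef sp sq /= => -> ->; rewrite subrr.
by rewrite !nth_default ?sp ?sq // subrr.
Qed.

(** The norm of the last member is allowed to vanish: for a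
    functional carried by [k] nodes it is the product over all nodes. *)
Definition orth_system (R : realFieldType) (M : {poly R} -> R) k (p : nat -> {poly R}) :=
  forall j, (j <= k)%N ->
    monic_deg (p j) j /\ forall q : {poly R}, (size q <= j)%N -> M (p j * q) = 0.

Definition convex_cone (R : realFieldType) (C : {poly R} -> Prop) :=
  (forall p q, C p -> C q -> C (p + q)) /\ (forall c p, 0 <= c -> C p -> C (c *: p)).

Section RemoveNode.
Variables (R : realFieldType) (M : {poly R} -> R) (C : {poly R} -> Prop).
Hypotheses (ML : lin_functional M) (CC : convex_cone C).
Variables (K : nat) (p : nat -> {poly R}) (x : R).
Hypothesis orthp : orth_system M K.+1 p.
Hypothesis Cp : forall j, (j <= K)%N -> C (p j).
Hypothesis Mpos : forall q : {poly R}, q != 0 -> (size q <= K.+1)%N -> 0 < M (q * q).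
Hypothesis Mxpos : forall q : {poly R}, q != 0 -> (size q <= K)%N -> 0 < M (q * q * (x%:P - 'X)).
Hypothesis px : (p K.+1).[x] = 0.

Let c j := (p j.+1).[x] / (p j).[x].
Let q j : {poly R} := (p j.+1 - c j *: p j) %/ ('X - x%:P).
Let Mx (r : {poly R}) := M (r * (x%:P - 'X)).

Let MxL : lin_functional Mx.
Proof. by move=> e r s; rewrite /Mx mulrDl -scalerAl ML. Qed.

Let q_mul j : (p j).[x] != 0 -> q j * ('X - x%:P) = p j.+1 - c j *: p j.
Proof.
move=> h; rewrite /q divpK // -root_factor_theorem.
by apply/rootP; rewrite hornerD hornerN hornerZ divfK // subrr.
Qed.

Let Mx_q j (s : {poly R}) : (p j).[x] != 0 -> Mx (q j * s) = - M ((p j.+1 - c j *: p j) * s).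
Proof.
move=> h; rewrite /Mx -mulrA (mulrC s) mulrA -(opprB 'X) mulrN q_mul //.
by rewrite mulNr -scaleN1r (lin_functionalZ ML) mulN1r.
Qed.

Let q_monic j : (j <= K)%N -> (p j).[x] != 0 -> monic_deg (q j) j.
Proof.
move=> jK h; have [[m1 s1] _] := orthp (jK : (j.+1 <= K.+1)%N).
have [[m0 s0] _] := orthp (leqW jK).
have sz : (size (- (c j *: p j))%R < size (p j.+1))%N.
  by rewrite size_polyN s1 ltnS (leq_trans (size_scale_leq _ _)) // s0.
have qm : q j \is monic.
  by rewrite -(monicMr _ (monicXsubC x)) q_mul // monicE lead_coefDl // -monicE.
split=> //; apply/eqP; rewrite -eqSS.
have := congr1 (size \o val) (q_mul h); rewrite /= size_polyDl // s1 => <-.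
by rewrite size_Mmonic ?monic_neq0 ?monicXsubC // size_XsubC addn2.
Qed.

Let q_orth j (s : {poly R}) : (j <= K)%N -> (p j).[x] != 0 -> (size s <= j)%N -> Mx (q j * s) = 0.
Proof.
move=> jK h hs; rewrite Mx_q // mulrBl -scalerAl (lin_functionalB ML) (lin_functionalZ ML).
by rewrite (orthp (jK : (j.+1 <= K.+1)%N)).2 ?(leqW hs) // (orthp (leqW jK)).2 // mulr0 subr0 oppr0.
Qed.

Let p_norm j r : (j <= K.+1)%N -> monic_deg r j -> M (p j * r) = M (p j * p j).
Proof.
move=> jK hr; rewrite -[r](subrK (p j)) mulrDr (lin_functionalD ML).
rewrite (orthp jK).2 ?add0r //; apply: monic_deg_subr => //.
by have [] := orthp jK.
Qed.

Let p_norm_gt0 j : (j <= K)%N -> 0 < M (p j * p j).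
Proof.
move=> jK; have [[m s] _] := orthp (leqW jK).
by apply: Mpos; rewrite ?monic_neq0 // s.
Qed.

Let Mx_norm j : (j <= K)%N -> (p j).[x] != 0 -> Mx (q j * q j) = c j * M (p j * p j).
Proof.
move=> jK h; have [mq sq] := q_monic jK h.
rewrite Mx_q // mulrBl -scalerAl (lin_functionalB ML) (lin_functionalZ ML).
rewrite (orthp (jK : (j.+1 <= K.+1)%N)).2 ?sq // sub0r opprK p_norm //; first exact: leqW.
Qed.

Let q_norm_gt0 j : (j < K)%N -> (p j).[x] != 0 -> 0 < Mx (q j * q j).
Proof.
move=> jK h; have [mq sq] := q_monic (ltnW jK) h.
by apply: Mxpos; rewrite ?monic_neq0 // sq.
Qed.

Let p_gt0 j : (j <= K)%N -> 0 < (p j).[x].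
Proof.
elim: j => [|j IH] jK.
  have [[/monicP m s] _] := orthp (leq0n K.+1).
  have /size_poly1P[e e0 pe] : size (p 0%N) == 1%N by rewrite s.
  by move: m; rewrite pe lead_coefC hornerC => ->; exact: ltr01.
have h := IH (ltnW jK); have h0 : (p j).[x] != 0 by rewrite gt_eqF.
have : 0 < c j.
  by have := q_norm_gt0 jK h0; rewrite (Mx_norm (ltnW jK) h0) (pmulr_lgt0 _ (p_norm_gt0 (ltnW jK))).
by rewrite /c pmulr_lgt0 // invr_gt0.
Qed.

Let p_neq0 j : (j <= K)%N -> (p j).[x] != 0.
Proof. by move=> jK; rewrite gt_eqF ?p_gt0. Qed.

Let q_step j : (j < K)%N -> exists2 e, 0 < e & q j.+1 = p j.+1 + e *: q j.
Proof.
move=> jK; have hj := p_neq0 (ltnW jK); have hj1 := p_neq0 jK.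
have mq1 := q_monic jK hj1; have [mp1 op1] := orthp (leqW jK : (j.+1 <= K.+1)%N).
have mq := q_monic (ltnW jK) hj.
pose d := q j.+1 - p j.+1; have sd : (size d <= j.+1)%N by exact: monic_deg_subr.
have Mxp (s : {poly R}) : (size s <= j)%N -> Mx (p j.+1 * s) = 0.
  move=> hs; rewrite /Mx -mulrA op1 // (leq_trans (size_polyMleq _ _)) //.
  by rewrite -opprB size_polyN size_XsubC addn2.
have Mxd (s : {poly R}) : (size s <= j)%N -> Mx (d * s) = 0.
  by move=> hs; rewrite /d mulrBl (lin_functionalB MxL) (q_orth jK hj1) ?leqW // Mxp // subrr.
pose e := d`_j.
have dE : d = e *: q j.
  apply/eqP; rewrite -subr_eq0; apply/negPn/negP => h.
  have sz : (size (d - e *: q j)%R <= j)%N.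
    apply/leq_sizeP => i; rewrite leq_eqVlt => /orP[/eqP <-|ji]; rewrite coefB coefZ.
      by have [/monicP + sq] := mq; rewrite /lead_coef sq /= => ->; rewrite mulr1 subrr.
    have -> : d`_i = 0 by apply/nth_default/(leq_trans sd).
    by rewrite nth_default ?mq.2 // mulr0 subr0.
  have Mz : Mx ((d - e *: q j) * (d - e *: q j)) = 0.
    rewrite mulrBl (lin_functionalB MxL) -scalerAl (lin_functionalZ MxL).
    by rewrite (Mxd _ sz) (q_orth (ltnW jK) hj sz) mulr0 subr0.
  have := Mxpos h (leq_trans sz (ltnW jK)).
  by rewrite [X in 0 < X](Mz : M _ = 0) ltxx.
exists e; last by rewrite -dE addrC subrK.
have : Mx (d * q j) = M (p j.+1 * p j.+1).
  rewrite /d mulrBl (lin_functionalB MxL) (q_orth jK hj1) ?mq.2 // sub0r.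
  have qx : q j * (x%:P - 'X) = (- 1) *: (p j.+1 - c j *: p j).
    by rewrite -(opprB 'X) mulrN q_mul // scaleN1r.
  rewrite /Mx -mulrA qx -scalerAr (lin_functionalZ ML) mulN1r opprK p_norm //; first exact: leqW.
  have [m1 s1] := mp1; have [[m0 s0] _] := orthp (leqW (ltnW jK)).
  have sz : (size (- (c j *: p j))%R < size (p j.+1))%N.
    by rewrite size_polyN s1 ltnS (leq_trans (size_scale_leq _ _)) // s0.
  by split; rewrite ?monicE ?lead_coefDl ?size_polyDl // -monicE.
rewrite dE -scalerAl (lin_functionalZ MxL) => h.
by have := p_norm_gt0 jK; rewrite -h pmulr_lgt0 // q_norm_gt0.
Qed.

Let Cq j : (j <= K)%N -> C (q j).
Proof.
elim: j => [|j IH] jK.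
  have := q_monic jK (p_neq0 jK); have [mp _] := orthp (leq0n K.+1).
  move=> /monic_deg_subr/(_ mp); rewrite leqn0 size_poly_eq0 subr_eq0 => /eqP ->.
  exact: Cp.
have [e e0 ->] := q_step jK; apply: CC.1; first exact: Cp.
by apply: CC.2; [exact: ltW|exact/IH/ltnW].
Qed.

(** The factor [x - X] removes the node [x] from the functional. By
    Christoffel's formula, the new orthogonal polynomials are
    [q_j = (p_(j+1) - c_j p_j) / (X - x)] with [c_j = p_(j+1) (x) / p_j (x)].
    Comparing norms shows [c_j > 0], hence inductively [p_j (x) > 0]. Moreover
    [q_(j+1) - p_(j+1)] is orthogonal to degrees below [j], so it is a multiple
    of [q_j], and the multiple is positive; this puts [q_j] in the cone. *)
Lemma remove_node : exists q' : nat -> {poly R},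
  [/\ orth_system (fun r => M (r * (x%:P - 'X))) K q',
      forall j, (j <= K)%N -> C (q' j) & q' K * ('X - x%:P) = p K.+1].
Proof.
exists q; split.
- by move=> j jK; split; [exact: q_monic (p_neq0 jK)|move=> s; exact: q_orth (p_neq0 jK)].
- exact: Cq.
- by rewrite q_mul ?p_neq0 // /c px mul0r scale0r subr0.
Qed.
End RemoveNode.

Section PrefixProducts.
Variables (R : realFieldType) (M : {poly R} -> R) (C : {poly R} -> Prop).
Hypotheses (ML : lin_functional M) (CC : convex_cone C).
Variables (N : nat) (r : nat -> R).

Definition node_poly k : {poly R} := \prod_(i < k) ('X - (r i)%:P).
(** As a factor inside a functional carried by the [N] nodes, this
    removes the nodes of index at least [k]. *)
Definition tail_poly k : {poly R} := \prod_(k <= i < N) ((r i)%:P - 'X).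

(** Once the nodes of index at least [k] are removed, the
    product over the remaining ones is the last orthogonal polynomial. *)
Lemma prefix_products_in_cone (p : nat -> {poly R}) :
  (forall q, M (node_poly N * q) = 0) ->
  (forall k (q : {poly R}), (k <= N)%N -> q != 0 -> (size q <= k)%N -> 0 < M (q * q * tail_poly k)) ->
  (forall j, (j < N)%N -> [/\ monic_deg (p j) j, C (p j) &
     forall q : {poly R}, (size q <= j)%N -> M (p j * q) = 0]) ->
  forall k, (k < N)%N -> C (node_poly k).
Proof.
move=> Mnode Mpos hp k kN.
have mnode j : monic_deg (node_poly j) j.
  split; first by apply: monic_prod => i _; exact: monicXsubC.
  by rewrite /node_poly size_prod_XsubC /index_enum -enumT size_enum_ord.
suff : forall d, (d <= N)%N -> exists p' : nat -> {poly R},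
  [/\ orth_system (fun q => M (q * tail_poly (N - d))) (N - d) p',
      forall j, (j < N - d)%N -> C (p' j), p' (N - d)%N = node_poly (N - d)
      & (0 < d)%N -> C (p' (N - d)%N)].
  move=> /(_ (N - k)%N (leq_subr _ _))[p' [_ _ e h]].
  by move: h; rewrite e (subKn (ltnW kN)); apply; rewrite subn_gt0.
elim=> [_|d IH dN].
  exists (fun j => if (j < N)%N then p j else node_poly j).
  rewrite subn0 /tail_poly big_geq // ltnn; split => //.
  - move=> j; rewrite leq_eqVlt => /orP[/eqP ->|jN].
      by rewrite ltnn; split => // q _; rewrite mulr1.
    by rewrite jN; have [? _ h] := hp j jN; split => // q sq; rewrite mulr1 h.
  - by move=> j jN; rewrite jN; have [] := hp j jN.
have [pd [hod Cd ed _]] := IH (ltnW dN).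
have Nd : (N - d)%N = (N - d.+1).+1 by rewrite subnS prednK // subn_gt0.
set K := (N - d.+1)%N in Nd *; rewrite Nd in hod Cd ed.
have tE : tail_poly K = ((r K)%:P - 'X) * tail_poly K.+1.
  by rewrite /tail_poly big_ltn // /K -subSn // subSS leq_subr.
have ML' : lin_functional (fun q => M (q * tail_poly K.+1)).
  by move=> e u v; rewrite mulrDl -scalerAl ML.
have KN : (K < N)%N by rewrite -Nd leq_subr.
have [] := @remove_node R (fun q => M (q * tail_poly K.+1)) C ML' CC K pd (r K) hod.
- by move=> j jK; exact: Cd.
- by move=> q q0 sq; exact: Mpos.
- by move=> q q0 sq; rewrite -mulrA -tE; apply: Mpos => //; exact: ltnW.
- by rewrite ed /node_poly big_ord_recr hornerM hornerXsubC subrr mulr0.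
move=> qd [ho1 C1 t1]; exists qd; split => //.
- move=> j jK; have [m1 h1] := ho1 j jK; split => // s hs.
  by rewrite tE mulrA; exact: h1.
- by move=> j jK; exact: C1 (ltnW jK).
- apply: (mulIf (monic_neq0 (monicXsubC (r K)))).
  by rewrite t1 ed /node_poly big_ord_recr.
- by move=> _; exact: C1.
Qed.
End PrefixProducts.

(** * Rolle's theorem with double zeros *)

Lemma rolle_unit (R : realType) (F F1 : R -> R) (x y : R) :
  0 <= x -> x < y -> y <= 1 ->
  (forall t : R, t \in `]0, 1[%R -> is_derive t 1 F (F1 t)) ->
  {within `[x, y], continuous F} -> F x = 0 -> F y = 0 ->
  exists c, [/\ x < c, c < y, c \in `]0, 1[%R & F1 c = 0].
Proof.
move=> x0 xy y1 dF cF Fx Fy.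
have sub (t : R) : t \in `]x, y[%R -> t \in `]0, 1[%R.
  by rewrite !in_itv /= => /andP[xt ty]; rewrite (le_lt_trans x0) ?(lt_le_trans ty).
have dxy (t : R) (ht : t \in `]x, y[%R) : is_derive t 1 F (F1 t) := dF t (sub t ht).
have [c ci h] := MVT xy dxy cF.
exists c; have := ci; rewrite {1}in_itv /= => /andP[xc cy]; split => //; first exact: sub.
move: h; rewrite Fx Fy subrr => /esym/eqP; rewrite mulf_eq0 => /orP[/eqP //|].
by rewrite subr_eq0 gt_eqF.
Qed.

Section DerivativeZeros.
Variables (R : realType) (F F1 : R -> R) (P : pred R).
Hypothesis rolle_F : forall x y, P x -> P y -> x < y -> F x = 0 -> F y = 0 ->
  exists c, [/\ x < c, c < y, c \in `]0, 1[%R & F1 c = 0].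

(** Rolle's theorem for a nondecreasing list of zeros of
    multiplicity at most two. The last clause tells whether [x] itself may be
    among the zeros found, which keeps them distinct in the induction. The
    predicate [P] is the closed interval for a function, and the open one for
    its derivatives. *)
Lemma derivative_zeros (x : R) (s : seq R) :
  path <=%R x s -> all P (x :: s) ->
  (forall y, (count_mem y (x :: s) <= 2)%N) ->
  (forall y, y \in x :: s -> F y = 0) ->
  (forall y, (2 <= count_mem y (x :: s))%N -> y \in `]0, 1[%R /\ F1 y = 0) ->
  exists s', [/\ size s' = size s, sorted <%R s',
    all (fun y : R => y \in `]0, 1[%R) s', (forall y, y \in s' -> F1 y = 0) &
    (all (fun y => x < y) s' \/
     (all (fun y => x <= y) s' /\ (exists s2, s = x :: s2)))].
Proof.
elim: s x => [|y s IH] x /=; first by move=> *; exists [::]; split => //; left.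
move=> /andP[xy ps] /andP[Px Ps] cnt z0 z1.
have [||||s' [ss' srt s'01 s'0 H]] := IH y ps.
- exact: Ps.
- by move=> u; apply: leq_trans (cnt u); rewrite leq_addl.
- by move=> u hu; apply: z0; rewrite inE hu orbT.
- by move=> u hu; apply: z1; rewrite (leq_trans hu) // leq_addl.
have s'y : all (fun u => y <= u) s'.
  by case: H => [h|[]//]; apply: sub_all h => u; exact: ltW.
move: xy; rewrite le_eqVlt => /orP[/eqP xy|xy].
  (* x = y is a double zero, hence a zero of F1; a third copy is excluded *)
  have s'y2 : all (fun u => y < u) s'.
    case: H => // -[_ [s2 e]]; have := cnt y; rewrite xy e /= !eqxx /=.
    by rewrite !add1n.
  have [y01 y1] : y \in `]0, 1[%R /\ F1 y = 0 by apply: z1; rewrite xy eqxx.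
  exists (y :: s'); split => /=.
  - by rewrite ss'.
  - by rewrite (path_sortedE lt_trans) srt andbT.
  - by rewrite y01.
  - by move=> u; rewrite inE => /orP[/eqP ->|/s'0].
  - by right; rewrite xy lexx; split; [exact: s'y|exists s].
have Py : P y by move: Ps => /= /andP[].
have Fx : F x = 0 by apply: z0; rewrite inE eqxx.
have Fy : F y = 0 by apply: z0; rewrite !inE eqxx orbT.
have [c [xc cy c01 Fc]] := rolle_F Px Py xy Fx Fy.
exists (c :: s'); split => /=.
- by rewrite ss'.
- rewrite (path_sortedE lt_trans) srt andbT.
  by apply: sub_all s'y => u; exact: lt_le_trans.
- by rewrite c01.
- by move=> u; rewrite inE => /orP[/eqP ->|/s'0].
- left; rewrite xc /=; apply: sub_all s'y => u; exact: lt_le_trans.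
Qed.
End DerivativeZeros.

Lemma rolle_iterated (R : realType) k (F : nat -> R -> R) (z : seq R) :
  size z = k.+1 -> sorted <%R z -> all (fun y : R => y \in `]0, 1[%R) z ->
  (forall y, y \in z -> F 0%N y = 0) ->
  (forall j (t : R), (j < k)%N -> t \in `]0, 1[%R -> is_derive t 1 (F j) (F j.+1 t)) ->
  exists2 xi, xi \in `]0, 1[%R & F k xi = 0.
Proof.
elim: k F z => [|k IH] F [|x s] //= [ss] srt zin z0 dF.
  exists x; first by have /andP[] := zin.
  by apply: z0; rewrite inE eqxx.
have us : uniq (x :: s) by apply: (@lt_sorted_uniq _ _ (x :: s)).
have cnt y : (count_mem y (x :: s) <= 1)%N.
  by rewrite count_uniq_mem //; case: (_ \in _).
have rF (u v : R) : u \in `]0, 1[%R -> v \in `]0, 1[%R -> u < v ->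
    F 0%N u = 0 -> F 0%N v = 0 ->
    exists c, [/\ u < c, c < v, c \in `]0, 1[%R & F 1%N c = 0].
  rewrite !in_itv /= => /andP[u0 u1] /andP[v0 v1] uv; apply: rolle_unit.
  - exact: ltW.
  - by [].
  - exact: ltW.
  - by move=> t; exact: dF.
  apply: continuous_in_subspaceT => t; rewrite inE /= in_itv /= => /andP[ut tv].
  have t01 : t \in `]0, 1[%R by rewrite in_itv /= (lt_le_trans u0) ?(le_lt_trans tv).
  by apply: differentiable_continuous; apply/derivable1_diffP; have [] := dF 0%N t erefl t01.
have [|||||s' [h1 h2 h3 h4 _]] :=
  @derivative_zeros R (F 0%N) (F 1%N) (fun y => y \in `]0, 1[%R) rF x s.
- exact: (sub_path (fun u v => @ltW _ _ u v)).
- exact: zin.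
- by move=> y; exact: leqW.
- exact: z0.
- by move=> y; rewrite ltnNge cnt.
apply: (IH (fun j => F j.+1) s') => //; first by rewrite h1.
by move=> j t jk t01; apply: dF.
Qed.

(** * Newton form of the Hermite interpolant *)

Section Hermite.
Variables (R : realType) (m : nat) (f : R -> R).
Hypothesis f_cont : {within `[0, 1], continuous f}.
Hypothesis f_der : derivable_upto m f.

Definition good_nodes (z : seq R) :=
  [/\ all (fun y : R => y \in `[0, 1]%R) z, (forall y, (count_mem y z <= 2)%N) &
    (forall y, (2 <= count_mem y z)%N -> y \in `]0, 1[%R)].

Definition hermite_at (g : {poly R}) (z : seq R) :=
  (forall y, y \in z -> g.[y] = f y) /\
  (forall y, (2 <= count_mem y z)%N -> g^`().[y] = derive1n 1 f y).

Lemma derivn_top (g : {poly R}) k xi : (size g <= k.+1)%N ->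
  g^`(k).[xi] = g`_k * k`!%:R.
Proof.
move=> sg; have -> : g^`(k) = (g`_k * k`!%:R)%:P.
  apply/polyP => i; rewrite coef_derivn coefC; case: i => [|i] /=.
    by rewrite addn0 ffactnn mulr_natr.
  by rewrite nth_default ?mul0rn // (leq_trans sg) // addnS ltnS leq_addr.
by rewrite hornerC.
Qed.

(** The difference of [f] and [g] has [k + 2] zeros with
    multiplicity, so its derivative of order [k + 1] has one. *)
Lemma hermite_top_coef (g : {poly R}) (z : seq R) k : (k.+1 <= m)%N ->
  size z = k.+2 -> good_nodes z -> hermite_at g z -> (size g <= k.+2)%N ->
  exists2 xi : R, xi \in `]0, 1[%R & derive1n k.+1 f xi = g`_k.+1 * (k.+1)`!%:R.
Proof.
move=> km sz [z01 zc zd] [h0 h1] sg.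
pose F j (t : R) := derive1n j f t - g^`(j).[t].
have dF j (t : R) : (j < k.+1)%N -> t \in `]0, 1[%R -> is_derive t 1 (F j) (F j.+1 t).
  move=> jk t01.
  change (is_derive t 1 (derive1n j f - horner g^`(j)) (derive1n j.+1 f t - g^`(j.+1).[t])).
  apply: is_deriveB.
    apply: DeriveDef; first by apply: f_der => //; exact: leq_trans jk km.
    by rewrite -derive1E -derive1nS.
have cF : {within `[0, 1], continuous (F 0%N)}.
  move=> t; apply: cvgB; first exact: f_cont.
  by apply: continuous_subspaceT; exact: continuous_horner.
have : perm_eq (sort <=%R z) z by rewrite perm_sort.
have : sorted <=%R (sort <=%R z) by apply: sort_sorted; exact: le_total.
case: (sort _ _) => [|x s] srt pz; first by have := perm_size pz; rewrite sz.
have cnt y : count_mem y (x :: s) = count_mem y z by apply/permP.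
have rF (u v : R) : u \in `[0, 1]%R -> v \in `[0, 1]%R -> u < v ->
    F 0%N u = 0 -> F 0%N v = 0 ->
    exists c, [/\ u < c, c < v, c \in `]0, 1[%R & F 1%N c = 0].
  rewrite !in_itv /= => /andP[u0 u1] /andP[v0 v1] uv; apply: rolle_unit => //.
    by move=> t; exact: dF.
  by apply: continuous_subspaceW cF; apply: subset_itvScc; rewrite bnd_simp.
have [||||s' [ss' srt' s'01 s'0 _]] :=
  @derivative_zeros R (F 0%N) (F 1%N) (fun y => y \in `[0, 1]%R) rF x s srt.
- by rewrite (perm_all _ pz).
- by move=> y; rewrite cnt.
- by move=> y; rewrite (perm_mem pz) => /h0 e; rewrite /F derivn0 e subrr.
- move=> y; rewrite cnt => hy; split; first exact: zd.
  by rewrite /F derivn1 (h1 _ hy) subrr.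
have ss : size s' = k.+1.
  by rewrite ss'; have := perm_size pz; rewrite /= sz => -[].
have dF' j (t : R) : (j < k)%N -> t \in `]0, 1[%R -> is_derive t 1 (F j.+1) (F j.+2 t).
  by move=> jk; exact: dF.
have [xi xi01 e] := @rolle_iterated R k (fun j => F j.+1) s' ss srt' s'01 s'0 dF'.
exists xi => //; apply/eqP; rewrite -subr_eq0 -(derivn_top xi sg); exact/eqP.
Qed.

Definition node_prod (z : seq R) : {poly R} := \prod_(x <- z) ('X - x%:P).

Lemma node_prod_root z y : ((node_prod z).[y] == 0) = (y \in z).
Proof. by rewrite -[_ == 0]/(root _ _) root_prod_XsubC. Qed.

Lemma node_prod_perm z x : x \in z ->
  node_prod z = ('X - x%:P) * node_prod (rem x z).
Proof. by move=> xz; rewrite /node_prod (perm_big _ (perm_to_rem xz)) big_cons. Qed.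

Lemma deriv_node_prod z y : y \in z ->
  (node_prod z)^`().[y] = (node_prod (rem y z)).[y].
Proof.
move=> yz; rewrite (node_prod_perm yz) derivM derivXsubC mul1r hornerD hornerM.
by rewrite hornerXsubC subrr mul0r addr0.
Qed.

Lemma deriv_node_prod_eq0 z y : y \in z ->
  ((node_prod z)^`().[y] == 0) = (2 <= count_mem y z)%N.
Proof.
move=> yz; rewrite deriv_node_prod // node_prod_root -has_pred1 has_count.
by rewrite count_rem yz /= eqxx subn_gt0.
Qed.

(** The new coefficient is determined by the value of [f] at a new
    node, or by its derivative at a node that occurs for the second time. *)
Lemma hermite_extend (g : {poly R}) z x : good_nodes (rcons z x) ->
  (size z <= m)%N -> (size g <= size z)%N -> hermite_at g z ->
  exists c, hermite_at (g + c *: node_prod z) (rcons z x) /\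
   ((0 < size z)%N -> exists2 xi : R, xi \in `]0, 1[%R &
      derive1n (size z) f xi = c * (size z)`!%:R).
Proof.
move=> gz zm sg [h0 h1].
have szp : size (node_prod z) = (size z).+1 by rewrite size_prod_XsubC.
suff [c hc] : exists c, hermite_at (g + c *: node_prod z) (rcons z x).
  exists c; split => //; case ez : (size z) => [//|k] _.
  have [|||xi xi01 e] := @hermite_top_coef (g + c *: node_prod z) (rcons z x) k _ _ gz hc.
  - by rewrite -ez.
  - by rewrite size_rcons ez.
  - rewrite (leq_trans (size_polyD _ _)) // geq_max (leq_trans sg) ?ez //=.
    by rewrite (leq_trans (size_scale_leq _ _)) // szp ez.
  exists xi => //; rewrite e; congr (_ * _).
  rewrite coefD coefZ nth_default ?add0r; last by rewrite (leq_trans sg) // ez.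
  have /monicP : node_prod z \is monic by apply: monic_prod_XsubC.
  by rewrite /lead_coef szp ez /= => ->; rewrite mulr1.
have cnt y : count_mem y (rcons z x) = (count_mem y z + (x == y))%N.
  by rewrite -cats1 count_cat /= addn0.
have [xz|xz] := boolP (x \in z); last first.
  exists ((f x - g.[x]) / (node_prod z).[x]).
  split=> y; rewrite ?mem_rcons ?inE ?cnt.
    case/orP => [/eqP ->|yz].
      by rewrite hornerD hornerZ divfK ?node_prod_root // addrC subrK.
    have : (node_prod z).[y] == 0 by rewrite node_prod_root.
    by rewrite hornerD hornerZ => /eqP ->; rewrite mulr0 addr0 h0.
  have [<-|_] := eqVneq x y; first by rewrite (count_memPn xz).
  rewrite addn0 => hy; have yz : y \in z by rewrite -has_pred1 has_count ltnW.
  rewrite derivD derivZ hornerD hornerZ h1 //.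
  by have := deriv_node_prod_eq0 yz; rewrite hy => /eqP ->; rewrite mulr0 addr0.
have c1 : count_mem x z = 1%N.
  have [_ /(_ x) + _] := gz; rewrite cnt eqxx addn1 ltnS leq_eqVlt ltnS leqn0.
  case/orP => /eqP // e0; move: xz; rewrite -has_pred1 has_count e0 //.
exists ((derive1n 1 f x - g^`().[x]) / (node_prod z)^`().[x]).
have dn : (node_prod z)^`().[x] != 0 by rewrite deriv_node_prod_eq0 // c1.
split=> y; rewrite ?mem_rcons ?inE ?cnt.
  move=> hy; have yz : y \in z by case/orP: hy => [/eqP ->|].
  have : (node_prod z).[y] == 0 by rewrite node_prod_root.
  by rewrite hornerD hornerZ => /eqP ->; rewrite mulr0 addr0 h0.
have [<-|_] := eqVneq x y.
  by move=> _; rewrite derivD derivZ hornerD hornerZ divfK // addrC subrK.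
rewrite addn0 => hy; have yz : y \in z by rewrite -has_pred1 has_count ltnW.
rewrite derivD derivZ hornerD hornerZ h1 //.
by have := deriv_node_prod_eq0 yz; rewrite hy => /eqP ->; rewrite mulr0 addr0.
Qed.

Definition newton_form (z : seq R) (c : nat -> R) : {poly R} :=
  \sum_(i < size z) c i *: node_prod (take i z).

Lemma size_newton_form z c : (size (newton_form z c) <= size z)%N.
Proof.
rewrite /newton_form; apply: (leq_trans (size_sum _ _ _)).
apply/bigmax_leqP => i _; rewrite (leq_trans (size_scale_leq _ _)) //.
by rewrite size_prod_XsubC size_take ltn_ord.
Qed.

Lemma good_nodes_rcons z x : good_nodes (rcons z x) -> good_nodes z.
Proof.
move=> [h1 h2 h3].
have cnt y : (count_mem y z <= count_mem y (rcons z x))%N.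
  by rewrite -cats1 count_cat leq_addr.
split; first by move: h1; rewrite all_rcons => /andP[].
  by move=> y; apply: leq_trans (h2 y).
by move=> y hy; apply: h3; apply: leq_trans (cnt y).
Qed.

Lemma newton_hermite z : good_nodes z -> (size z <= m)%N ->
  exists c, hermite_at (newton_form z c) z /\
    forall i, (0 < i < size z)%N -> exists2 xi : R, xi \in `]0, 1[%R &
      derive1n i f xi = c i * i`!%:R.
Proof.
elim/last_ind: z => [|z x IH] gz; first by exists (fun=> 0); split => [|[]].
rewrite size_rcons => zm.
have [c [hc dc]] := IH (good_nodes_rcons gz) (ltnW zm).
have [e [he de]] := hermite_extend gz (ltnW zm) (size_newton_form z c) hc.
exists (fun i => if i == size z then e else c i); split; last first.
  move=> i /andP[i0]; rewrite ltnS leq_eqVlt => /orP[/eqP ez|iz].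
    by rewrite ez eqxx; apply: de; rewrite -ez.
  by rewrite ltn_eqF //; apply: dc; rewrite i0.
congr hermite_at: he; rewrite /newton_form size_rcons big_ord_recr /= eqxx.
rewrite -cats1 take_size_cat //; congr (_ + _); apply: eq_bigr => i _.
by rewrite ltn_eqF // take_cat ltn_ord.
Qed.

(** Interpolate at [u] too. *)
Lemma hermite_remainder z (g : {poly R}) u : good_nodes z -> size z = m -> (0 < m)%N ->
  (size g <= m)%N -> hermite_at g z -> u \in `[0, 1]%R -> u \notin z ->
  exists2 xi : R, xi \in `]0, 1[%R &
    (f u - g.[u]) * m`!%:R = derive1n m f xi * (node_prod z).[u].
Proof.
move=> [g1 g2 g3] sz m0 sg hg u01 uz.
have gz : good_nodes (rcons z u).
  have cnt y : count_mem y (rcons z u) = (count_mem y z + (u == y))%N.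
    by rewrite -cats1 count_cat /= addn0.
  split; first by rewrite all_rcons u01.
    move=> y; rewrite cnt; case: eqVneq => [<-|_]; last by rewrite addn0.
    by rewrite (count_memPn uz).
  move=> y; rewrite cnt; case: eqVneq => [<-|_]; first by rewrite (count_memPn uz).
  by rewrite addn0; exact: g3.
have [||c [[h0 _] hd]] := @hermite_extend g z u gz _ _ hg; rewrite ?sz //.
rewrite sz in hd; have [xi xi01 e] := hd m0; exists xi => //.
rewrite e -h0 ?mem_rcons ?inE ?eqxx // hornerD hornerZ; ring.
Qed.
End Hermite.

(** * Nodes attached to a symmetric set of inner products *)

Section SquaredNodes.
Variables (R : realType) (al : seq R).
Hypotheses (al_uniq : uniq al) (al_bnd : forall t, t \in al -> -1 < t < 1)
  (al_sym : forall t, t \in al -> - t \in al).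

Definition posA : seq R := sort <=%R [seq t <- al | 0 < t].
Notation s := (size posA).
Definition zeroA : bool := 0 \in al.
(** The squares of the positive elements of [al] in increasing order,
    followed by [1], the squared inner product of a point with itself. *)
Definition sqnode (i : nat) : R := if (i < s)%N then (nth 0 posA i) ^+ 2 else 1.

Lemma mem_posA t : (t \in posA) = (0 < t) && (t \in al).
Proof. by rewrite mem_sort mem_filter. Qed.

Lemma size_alE : size al = (2 * s + zeroA)%N.
Proof.
have cneg : count (fun t => t < 0) al = count (fun t => 0 < t) al.
  have p : perm_eq [seq - t | t <- al] al.
    apply: uniq_perm => //; first by rewrite map_inj_uniq //; exact: oppr_inj.
    move=> t; apply/mapP/idP => [[u ual ->]|tal]; first exact: al_sym.
    by exists (- t); rewrite ?opprK //; exact: al_sym.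
  rewrite -(permP p) count_map; apply: eq_count => t /=.
  by rewrite oppr_lt0.
have c0 : count (fun t => t == 0) al = zeroA.
  by rewrite /zeroA -(count_uniq_mem _ al_uniq); apply: eq_count => t.
rewrite size_sort size_filter -(count_predC (fun t => 0 < t)) mul2n -addnn -addnA.
congr (_ + _)%N; rewrite -{}c0 -{1}cneg -count_predUI.
rewrite [X in (_ + X)%N](_ : _ = 0%N) ?addn0; last first.
  by apply/eqP; rewrite -leqn0 leqNgt -has_count; apply/hasPn => t _ /=; case: ltgtP.
by apply: eq_count => t /=; rewrite -leNgt le_eqVlt orbC.
Qed.

Lemma posA_nth i : (i < s)%N ->
  [/\ 0 < nth 0 posA i, nth 0 posA i < 1 & nth 0 posA i \in al].
Proof.
move=> /(mem_nth 0); rewrite mem_posA => /andP[p0 pal].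
by have /andP[_ p1] := al_bnd pal.
Qed.

Lemma sqnode_last : sqnode s = 1. Proof. by rewrite /sqnode ltnn. Qed.

Lemma sqnode_bnd i : (i < s)%N -> 0 < sqnode i < 1.
Proof.
move=> h; rewrite /sqnode h; have [p0 p1 _] := posA_nth h.
by rewrite exprn_gt0 //= expr_lt1 // ltW.
Qed.

Lemma sqnode_gt0 i : 0 < sqnode i.
Proof. by rewrite /sqnode; case: ifP => // h; rewrite exprn_gt0 //; have [] := posA_nth h. Qed.

Lemma sqnode_lt i j : (i < j)%N -> (j <= s)%N -> sqnode i < sqnode j.
Proof.
move=> ij; rewrite leq_eqVlt => /orP[/eqP ej|js].
  rewrite [ltRHS](_ : _ = 1) ?ej ?sqnode_last //.
  by have /andP[] := sqnode_bnd (leq_trans ij (eq_leq ej)).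
have is_ := ltn_trans ij js; have [i0 _ _] := posA_nth is_; have [j0 _ _] := posA_nth js.
rewrite /sqnode is_ js ltr_pXn2r ?nnegrE ?ltW //.
have srt : sorted <%R posA by rewrite sort_lt_sorted filter_uniq.
by apply: (sorted_ltn_nth lt_trans 0 srt); rewrite ?inE.
Qed.

Lemma sqnodeP t : t \in al -> t != 0 -> exists2 k, (k < s)%N & t ^+ 2 = sqnode k.
Proof.
move=> tal t0; have tp : `|t| \in posA.
  by rewrite mem_posA normr_gt0 t0 /=; case: (ger0P t) => // _; exact: al_sym.
exists (index `|t| posA); first by rewrite index_mem.
by rewrite /sqnode index_mem tp nth_index // real_normK // num_real.
Qed.

Definition doubled (v : seq R) := flatten [seq [:: x; x] | x <- v].

(** In this order, every prefix is, up to the node [0], the union of two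
    prefixes of the list of simple nodes. *)
Definition nodes : seq R :=
  (if zeroA then [:: 0] else [::]) ++ doubled (mkseq sqnode s).

Lemma size_doubled v : size (doubled v) = (size v).*2.
Proof. by elim: v => //= x v IH; rewrite IH doubleS. Qed.

Lemma count_doubled v y : count_mem y (doubled v) = (count_mem y v).*2.
Proof. by elim: v => //= x v ->; rewrite doubleD -[in RHS]addnn addnA. Qed.

Lemma mem_doubled v y : (y \in doubled v) = (y \in v).
Proof. by rewrite -!has_pred1 !has_count count_doubled double_gt0. Qed.

Lemma node_prod_take_doubled v i : node_prod (take i (doubled v)) =
  node_prod (take i./2 v) * node_prod (take (uphalf i) v).
Proof.
elim: v i => [|x v IH] i; first by rewrite /= /node_prod !big_nil mulr1.
case: i => [|[|i]]; rewrite /node_prod /=.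
- by rewrite !big_nil mulr1.
- by rewrite !take0 !big_cons !big_nil mul1r.
by rewrite !big_cons; rewrite -!/(node_prod _) IH; ring.
Qed.

Lemma node_prod_mkseq j : (j <= s)%N ->
  node_prod (take j (mkseq sqnode s)) = node_poly sqnode j.
Proof.
move=> js; rewrite /node_prod /node_poly /mkseq -map_take take_iota (minn_idPl js) big_map.
by rewrite -[iota 0 j](_ : index_iota 0 j = _) ?big_mkord // /index_iota subn0.
Qed.

Lemma size_nodes : size nodes = size al.
Proof.
rewrite size_alE size_cat size_doubled size_mkseq -mul2n addnC.
by case: zeroA.
Qed.

Lemma mem_nodes y : (y \in nodes) = (zeroA && (y == 0)) || (y \in mkseq sqnode s).
Proof. by rewrite mem_cat mem_doubled; case: zeroA; rewrite ?inE. Qed.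

Lemma mem_sq_nodes t : (t ^+ 2 \in nodes) = (t \in al).
Proof.
rewrite mem_nodes sqrf_eq0; have [->|t0] := eqVneq t 0.
  rewrite andbT -/zeroA; case: zeroA => //=; apply/negP => /mapP[i].
  rewrite mem_iota add0n => /andP[_ h]; rewrite expr0n /= => e.
  by have := sqnode_gt0 i; rewrite -e ltxx.
rewrite andbF /=; apply/idP/idP => [/mapP[i]|tal].
  rewrite mem_iota add0n => /andP[_ h]; rewrite /sqnode h => /eqP.
  have [_ _ pal] := posA_nth h.
  by rewrite eqf_sqr => /orP[/eqP ->|/eqP ->] //; exact: al_sym.
have [k ks ->] := sqnodeP tal t0; apply/mapP; exists k => //.
by rewrite mem_iota add0n.
Qed.

Lemma one_notin_nodes : 1 \notin nodes.
Proof.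
have := mem_sq_nodes 1; rewrite expr1n => ->.
by apply/negP => /al_bnd; rewrite ltxx andbF.
Qed.

Lemma uniq_sqnodes : uniq (mkseq sqnode s).
Proof.
apply/mkseq_uniqP => i j; rewrite !inE => hi hj e.
apply/eqP; case: ltngtP => // h.
- by have := sqnode_lt h (ltnW hj); rewrite e ltxx.
- by have := sqnode_lt h (ltnW hi); rewrite e ltxx.
Qed.

Lemma good_nodes_nodes : good_nodes nodes.
Proof.
have v01 y : y \in mkseq sqnode s -> 0 < y < 1.
  move=> /mapP[i]; rewrite mem_iota add0n => /andP[_ h] ->; exact: sqnode_bnd.
have c0 : count_mem 0 (mkseq sqnode s) = 0%N.
  by apply/count_memPn/negP => /v01; rewrite ltxx.
have cu y : (count_mem y (mkseq sqnode s) <= 1)%N.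
  by rewrite count_uniq_mem ?uniq_sqnodes //; case: (_ \in _).
have cn y : count_mem y nodes = ((zeroA && (0%R == y)) + (count_mem y (mkseq sqnode s)).*2)%N.
  by rewrite /nodes count_cat count_doubled; case: zeroA; rewrite /= ?addn0.
split.
- apply/allP => y; rewrite mem_nodes in_itv /= => /orP[/andP[_ /eqP ->]|/v01 /andP[y0 y1]].
    by rewrite lexx ler01.
  by rewrite !ltW.
- move=> y; rewrite cn; have [<-|y0] := eqVneq 0 y; first by rewrite c0 addn0; case: zeroA.
  by rewrite andbF add0n -[2%N]/(1.*2) leq_double.
- move=> y; rewrite cn; have [<-|y0] := eqVneq 0 y; first by rewrite c0 addn0; case: zeroA.
  rewrite andbF add0n => h; rewrite in_itv /=; apply: v01.
  by rewrite -has_pred1 has_count; move: h; case: (count_mem _ _).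
Qed.

Lemma node_prod_nodesE (u : R) : (node_prod nodes).[u] =
  u ^+ zeroA * (node_poly sqnode s).[u] ^+ 2.
Proof.
have e : node_prod (doubled (mkseq sqnode s)) = node_poly sqnode s * node_poly sqnode s.
  have h := node_prod_take_doubled (mkseq sqnode s) s.*2.
  move: h; rewrite take_oversize ?size_doubled ?size_mkseq // => ->.
  by rewrite doubleK uphalf_double !node_prod_mkseq.
rewrite /nodes /node_prod big_cat -/(node_prod _) -/(node_prod (doubled _)) e.
rewrite hornerM hornerM -expr2; congr (_ * _).
by rewrite /node_prod; case: zeroA; rewrite ?big_seq1 ?big_nil ?hornerE // subr0.
Qed.
End SquaredNodes.

(** * Averages over designs *)

Section Parity.
Variables (R : realType) (n : nat).
Hypothesis n2 : (2 <= n)%N.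
Notation Z := (@zonalP R n).

(** By parity, [zonalP (2 l + b)] is [X ^ b] times a polynomial in
    [X ^ 2]. *)
Definition zonal_half (b : bool) l : {poly R} :=
  if b then odd_poly (Z (2 * l + b)) else even_poly (Z (2 * l + b)).

Lemma zonalP_half (b : bool) l : Z (2 * l + b) = 'X ^+ b * (zonal_half b l \Po 'X^2).
Proof.
apply/eqP; rewrite -subr_eq0; apply/eqP/poly_eq0_itv => t _.
have ev (q : {poly R}) u : (q \Po 'X^2).[u] = q.[u ^+ 2] by rewrite horner_comp hornerXn.
have sg : (-1) ^+ (2 * l + b) = (-1) ^+ b :> R by rewrite exprD exprM sqrrN !expr1n mul1r.
have zE u : (Z (2 * l + b)).[u] = (even_poly (Z (2 * l + b))).[u ^+ 2]
    + (odd_poly (Z (2 * l + b))).[u ^+ 2] * u.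
  by rewrite -[in LHS](poly_even_odd (Z (2 * l + b))) hornerD hornerM hornerX !ev.
have zN := zE (- t); move: (zE t) zN; rewrite sqrrN.
rewrite [in X in _ -> X -> _]horner_zonalP zonal_parity sg -horner_zonalP.
rewrite hornerD hornerN hornerM ev hornerXn /zonal_half.
case: b {sg zE} => /=; rewrite ?expr0 ?expr1;
  move: (Z _).[t] (even_poly _).[_] (odd_poly _).[_] => z e d; lra.
Qed.

Lemma pos_lead_zonal_half (b : bool) l : pos_lead (zonal_half b l) l.
Proof.
rewrite /zonal_half; have [h1 h2] := @pos_lead_zonalP R n n2 (2 * l + b).
case: b h1 h2 => h1 h2; split.
- apply: (leq_trans (size_odd_poly _)); rewrite -[l.+1](doubleK l.+1).
  by apply: half_leq; rewrite (leq_trans h1) // -mul2n /= ?addn0 ?addn1; lia.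
- by rewrite coef_odd_poly -mul2n -[(2 * l).+1]addn1.
- apply: (leq_trans (size_even_poly _)); rewrite -[l.+1](uphalf_double l.+1).
  by apply: uphalf_leq; rewrite (leq_trans h1) // -mul2n /= ?addn0 ?addn1; lia.
- by rewrite coef_even_poly -mul2n -[X in _`_X]addn0.
Qed.
End Parity.

Section DesignExactness.
Variables (R : realType) (n N m : nat).
Hypotheses (n2 : (2 <= n)%N) (m1 : (1 <= m)%N).
Notation L := (@gegen_int R n).
Notation Z := (@zonalP R n).

(** The mean of [p ((x . y) ^ 2)] for [y] uniform on the sphere. *)
Definition sq_mean (p : {poly R}) : R := L (p \Po 'X^2) / L 1.

Lemma gegen_int1_gt0 : 0 < L 1.
Proof. by apply: gegen_int_gt0 => //; [exact: oner_neq0|move=> t _; rewrite hornerC]. Qed.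

Lemma sq_mean_linear : lin_functional sq_mean.
Proof.
move=> c p q; rewrite /sq_mean comp_polyD comp_polyZ (gegen_int_linear n2).
by rewrite mulrDl mulrA.
Qed.

Lemma sq_mean_zonal_half l : sq_mean (zonal_half R n false l) = (l == 0)%:R.
Proof.
rewrite /sq_mean; have := zonalP_half R n false l; rewrite addn0 expr0 mul1r => <-.
case: l => [|l]; first by rewrite muln0 divff // gt_eqF ?gegen_int1_gt0.
by rewrite -[Z _]mulr1 (gegen_int_zonalP n2) ?mul0r // size_poly1.
Qed.

Lemma zonal_half_ind (P : {poly R} -> Prop) k : P 0 ->
  (forall c q r, P q -> P r -> P (c *: q + r)) ->
  (forall l, (l < k)%N -> P (zonal_half R n false l)) ->
  forall q : {poly R}, (size q <= k)%N -> P q.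
Proof.
move=> P0 PD Pz; apply: (poly_triangular_ind (p := zonal_half R n false) P0 PD) => l lk.
have [h1 h2] := pos_lead_zonal_half R n2 false l.
by split; [exact: h1|rewrite gt_eqF|exact: Pz].
Qed.

Lemma horner_zonal_half0 l t : (zonal_half R n false l).[t ^+ 2] = (Z (2 * l)).[t].
Proof.
by have := zonalP_half R n false l; rewrite addn0 expr0 mul1r => ->; rewrite horner_comp hornerXn.
Qed.

Lemma gegenbauer_horner l (t : R) :
  (gegenbauer R n (2 * l)).[t] = (Z (2 * l)).[1]^-1 * (Z (2 * l)).[t].
Proof. by rewrite gegenbauer_zonal // hornerZ. Qed.

Lemma psd_zonalP d : psd_on_sphere n (fun t => (Z d).[t]).
Proof.
apply: psd_ext (@psd_zonal R n d (ltnW n2)) => t.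
by rewrite horner_zonalP.
Qed.

Lemma design_zonal (x : 'I_N -> 'rV[R]_n) w l : is_design m.-1 x w -> (1 <= l < m)%N ->
  \sum_(i < N) \sum_(j < N) w i * w j * (Z (2 * l)).[dot (x i) (x j)] = 0.
Proof.
move=> [_ h] /andP[l1 lm].
have /h : (1 <= l <= m.-1)%N by rewrite l1 -ltnS prednK.
have z0 : (Z (2 * l)).[1]^-1 != 0 by rewrite invr_eq0 gt_eqF ?horner1_zonalP_gt0.
move=> e; apply: (mulfI z0); rewrite mulr0 -[RHS]e mulr_sumr.
apply: eq_bigr => i _; rewrite mulr_sumr; apply: eq_bigr => j _.
by rewrite gegenbauer_horner mulrCA.
Qed.

(** The average around any point [y] of the sphere, rather than only
    over the pairs of points of the design, is exact thanks to
    [psd_annihilates]. *)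
Lemma design_exact (x : 'I_N -> 'rV[R]_n) w : is_design m.-1 x w ->
  forall p : {poly R}, (size p <= m)%N -> forall y, on_sphere y ->
  \sum_(j < N) w j * p.[dot y (x j) ^+ 2] = sq_mean p.
Proof.
move=> des p sp y yS; have [[_ xS w0 w1] _] := des; move: p sp; apply: zonal_half_ind.
- by rewrite (lin_functional0 sq_mean_linear) big1 // => j _; rewrite horner0 mulr0.
- move=> c q r hq hr; rewrite sq_mean_linear -hq -hr mulr_sumr -big_split.
  by apply: eq_bigr => j _ /=; rewrite hornerD hornerZ; ring.
case=> [|l] lm; rewrite sq_mean_zonal_half.
  rewrite eqxx -[RHS]w1; apply: eq_bigr => j _.
  by rewrite horner_zonal_half0 muln0 hornerC mulr1.
under eq_bigr => j _ do rewrite horner_zonal_half0.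
apply: (psd_annihilates (psd_zonalP _) xS yS).
exact: design_zonal.
Qed.

Lemma design_exact2 (x : 'I_N -> 'rV[R]_n) w : is_design m.-1 x w ->
  forall p : {poly R}, (size p <= m)%N ->
  \sum_(i < N) \sum_(j < N) w i * w j * p.[dot (x i) (x j) ^+ 2] = sq_mean p.
Proof.
move=> des p sp; have [[_ xS w0 w1] _] := des.
under eq_bigr => i _.
  under eq_bigr => j _ do rewrite -mulrA.
  rewrite -mulr_sumr (design_exact des sp (xS i)); over.
by rewrite -mulr_suml w1 mul1r.
Qed.

(** The polynomials [zonal_half false l] have mean [0] for
    [l > 0]. *)
Lemma exact_is_design (x : 'I_N -> 'rV[R]_n) w : weighted_code x w ->
  (forall p : {poly R}, (size p <= m)%N ->
  \sum_(i < N) \sum_(j < N) w i * w j * p.[dot (x i) (x j) ^+ 2] = sq_mean p) ->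
  is_design m.-1 x w.
Proof.
move=> wc h; split => // l /andP[l1 lm].
have [h1 _] := pos_lead_zonal_half R n2 false l.
have lm' : (l < m)%N by rewrite -(prednK m1) ltnS.
have l0 : (l == 0)%:R = 0 :> R by rewrite gtn_eqF.
have := h _ (leq_trans h1 lm'); rewrite sq_mean_zonal_half l0.
move/(congr1 ( *%R (Z (2 * l)).[1]^-1)); rewrite mulr0 => e.
apply: etrans e; rewrite mulr_sumr.
apply: eq_bigr => i _; rewrite mulr_sumr; apply: eq_bigr => j _.
by rewrite gegenbauer_horner horner_zonal_half0 mulrCA.
Qed.
End DesignExactness.

(** * Positive definiteness of the node polynomials *)

Section NodePolynomialsPSD.
Variables (R : realType) (n N : nat) (al : seq R).
Hypotheses (n2 : (2 <= n)%N) (N0 : (0 < N)%N).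
Hypotheses (al_uniq : uniq al) (al_bnd : forall t, t \in al -> -1 < t < 1)
  (al_sym : forall t, t \in al -> - t \in al) (al0 : (0 < size al)%N).
Variable xs : 'I_N -> 'rV[R]_n.
Hypothesis xs_design : is_design (size al).-1 xs (@equi_weights R N).
Hypothesis xs_dots : forall i j, i != j -> dot (xs i) (xs j) \in al.

Notation L := (@gegen_int R n).
Notation Z := (@zonalP R n).
Notation b := (zeroA al).
Notation s := (size (posA al)).
Notation r := (sqnode al).
Notation tau i j := (dot (xs i) (xs j) ^+ 2).

(** The factor [X ^ b] is present when [0] is in [al]. It removes
    the node [0], and the relevant polynomials are then the odd ones
    [t q (t ^ 2)]. *)
Definition code_functional (q : {poly R}) : R :=
  \sum_(i < N) \sum_(j < N) equi_weights R i * equi_weights R j * ('X^b * q).[tau i j].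
Notation M := code_functional.

Lemma code_functional_linear : lin_functional M.
Proof.
move=> c p q; rewrite /M mulr_sumr -big_split; apply: eq_bigr => i _ /=.
rewrite mulr_sumr -big_split; apply: eq_bigr => j _ /=.
by rewrite !hornerM hornerD hornerZ; ring.
Qed.

Lemma code_functional_exact (q : {poly R}) : (size ('X^b * q)%R <= size al)%N ->
  M q = sq_mean n ('X^b * q).
Proof. by move=> sq; rewrite /M (design_exact2 n2 al0 xs_design). Qed.

Lemma tau_cases i j : [\/ tau i j = 1, exists2 k, (k < s)%N & tau i j = r k
   | b = true /\ tau i j = 0].
Proof.
have [<-|ij] := eqVneq i j.
  by apply: Or31; have [[_ xS _ _] _] := xs_design; rewrite xS expr1n.
have tal := xs_dots ij.
have [t0|t0] := eqVneq (dot (xs i) (xs j)) 0.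
  by apply: Or33; rewrite t0 expr0n; split => //; rewrite /zeroA -t0.
have [k ks e] := sqnodeP al_sym tal t0.
by apply: Or32; exists k.
Qed.

Lemma tau_sqnode i j : (exists2 k, (k <= s)%N & tau i j = r k) \/ (b = true /\ tau i j = 0).
Proof.
case: (tau_cases i j) => [->|[k ks ->]|]; last by right.
  by left; exists s => //; rewrite sqnode_last.
by left; exists k => //; exact: ltnW.
Qed.

Lemma code_functional_node_poly (q : {poly R}) : M (node_poly r s.+1 * q) = 0.
Proof.
rewrite /M big1 // => i _; rewrite big1 // => j _.
case: (tau_sqnode i j) => [[k ks ->]|[-> ->]]; last first.
  by rewrite hornerM hornerXn expr0n /= mul0r mulr0.
rewrite !hornerM /node_poly horner_prod (bigD1 (Ordinal (ks : (k < s.+1)%N))) //=.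
by rewrite hornerXsubC subrr !(mul0r, mulr0).
Qed.

(** Otherwise some polynomial of admissible degree, nonnegative on
    [[0, 1]], would vanish at all squared inner products of the design,
    although its mean is positive. *)
Lemma sqnode_realized k : (k <= s)%N -> exists i j, tau i j = r k.
Proof.
rewrite leq_eqVlt => /orP[/eqP ->|ks].
  exists (Ordinal N0), (Ordinal N0); rewrite sqnode_last.
  by have [[_ xS _ _] _] := xs_design; rewrite xS expr1n.
(* P vanishes at 1, at 0 if 0 is in al, and at all nodes except r k *)
pose Q := \prod_(i < s | (i : nat) != k) ('X - (r i)%:P) : {poly R}.
pose P : {poly R} := 'X^b * ((1 - 'X) * (Q * Q)).
have Q0 : Q != 0 by apply/prodf_neq0 => i _; rewrite polyXsubC_eq0.
have X10 : (1 - 'X : {poly R}) != 0 by rewrite -opprB oppr_eq0 polyXsubC_eq0.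
have sQ : size Q = s.
  have e : node_poly r s = Q * ('X - (r k)%:P).
    by rewrite mulrC /node_poly (bigD1 (Ordinal ks)).
  have : size (node_poly r s) = s.+1.
    by rewrite /node_poly size_prod_XsubC /index_enum -enumT size_enum_ord.
  by rewrite e size_Mmonic ?monicXsubC // size_XsubC addn2 => -[].
have sP : (size P <= size al)%N.
  rewrite size_alE // /P size_monicM ?monicXn //; last by rewrite !mulf_neq0.
  rewrite size_polyXn !size_mul ?mulf_neq0 // sQ.
  rewrite -opprB size_polyN size_XsubC.
  by case: (s) ks => // u _; lia.
have P0 : P \Po 'X^2 != 0.
  rewrite comp_poly_eq0 ?size_polyXn // !mulf_neq0 ?expf_neq0 ?polyX_eq0 //.
have LP : 0 < L (P \Po 'X^2).
  apply: gegen_int_gt0 => // t; rewrite in_itv /= => /andP[t1 t2].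
  have tt : t ^+ 2 <= 1 by nra.
  rewrite horner_comp hornerXn /P hornerM hornerXn hornerM hornerM -expr2 hornerD hornerN hornerC hornerX.
  apply: mulr_ge0; first by rewrite exprn_ge0 // sqr_ge0.
  by rewrite mulr_ge0 ?sqr_ge0 // subr_ge0.
have hM : 0 < M ((1 - 'X) * (Q * Q)).
  by rewrite code_functional_exact // divr_gt0 // gegen_int1_gt0.
apply: contrapT => h; move: hM; rewrite /M big1 ?ltxx // => i _.
rewrite big1 // => j _; apply/eqP; rewrite mulf_eq0; apply/orP; right.
rewrite hornerM hornerXn hornerM hornerM hornerD hornerN hornerC hornerX !mulf_eq0.
case: (tau_cases i j) => [->|[l ls e]|[-> ->]].
- by rewrite subrr eqxx !orbT.
- have [lk|lk] := eqVneq l k; first by exfalso; apply: h; exists i, j; rewrite e lk.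
  rewrite e /Q horner_prod (bigD1 (Ordinal ls)) //= hornerXsubC subrr mul0r.
  by rewrite eqxx !orbT.
- by rewrite expr1 eqxx.
Qed.

(** All terms of the sum are nonnegative, and they vanish
    together only if [q] has the [k] smallest nodes as roots. *)
Lemma code_functional_pos k (q : {poly R}) : (k <= s.+1)%N -> q != 0 ->
  (size q <= k)%N -> 0 < M (q * q * tail_poly s.+1 r k).
Proof.
move=> ks q0 sq.
have w0 : 0 < equi_weights R (Ordinal N0) * equi_weights R (Ordinal N0).
  by rewrite mulr_gt0 // invr_gt0 ltr0n.
have tail_ge0 i : (i <= s)%N -> 0 <= (tail_poly s.+1 r k).[r i]
    /\ ((i < k)%N -> 0 < (tail_poly s.+1 r k).[r i]).
  move=> is_; rewrite /tail_poly horner_prod; split => [|ik].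
    have [ki|ik] := leqP k i; last first.
      rewrite big_nat_cond prodr_ge0 // => l /andP[/andP[kl ls] _].
      by rewrite !hornerE subr_ge0 ltW // sqnode_lt // (leq_trans ik).
    rewrite (bigD1_seq i) ?iota_uniq ?mem_index_iota ?ki ?ltnS //=.
    by rewrite hornerD hornerN hornerC hornerX subrr mul0r.
  rewrite big_nat_cond prodr_gt0 // => l /andP[/andP[kl ls] _].
  by rewrite !hornerE subr_gt0 sqnode_lt // (leq_trans ik).
have term_ge0 i j : 0 <= equi_weights R i * equi_weights R j *
    ('X^b * (q * q * tail_poly s.+1 r k)).[tau i j].
  rewrite mulr_ge0 ?mulr_ge0 ?invr_ge0 ?ler0n //.
  rewrite hornerM hornerXn hornerM hornerM -expr2.
  case: (tau_sqnode i j) => [[l ls ->]|[-> ->]]; last by rewrite expr1 mul0r.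
  apply: mulr_ge0; first by rewrite exprn_ge0 // ltW // sqnode_gt0.
  by rewrite mulr_ge0 ?sqr_ge0 // (tail_ge0 _ ls).1.
rewrite lt_neqAle eq_sym; apply/andP; split; last first.
  by apply: sumr_ge0 => i _; apply: sumr_ge0 => j _.
apply: contra q0 => /eqP e.
have z i j : equi_weights R i * equi_weights R j *
    ('X^b * (q * q * tail_poly s.+1 r k)).[tau i j] = 0.
  have ei := psumr_eq0P _ e; apply: (psumr_eq0P _ (ei _ i isT)) => // l _.
  by apply: sumr_ge0 => j' _.
apply/eqP; apply: (@roots_geq_poly_eq0 _ q (mkseq r k)).
- apply/allP => x /mapP[i]; rewrite mem_iota add0n => /andP[_ ik] ->.
  have is_ : (i <= s)%N by rewrite -ltnS (leq_trans ik).
  have [j [l hjl]] := sqnode_realized is_.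
  have := z j l; rewrite hjl hornerM hornerXn hornerM hornerM => /eqP.
  rewrite !mulf_eq0 !invr_eq0 !pnatr_eq0 !(gtn_eqF N0) /=.
  rewrite (gt_eqF (exprn_gt0 _ (sqnode_gt0 _ _))) //= (gt_eqF ((tail_ge0 _ is_).2 ik)) orbF orbb.
  by [].
- apply/mkseq_uniqP => i j; rewrite !inE => hi hj e2.
  apply/eqP; case: ltngtP => // h.
  + by have := sqnode_lt al_uniq al_bnd h; rewrite e2 ltxx -ltnS => /(_ (leq_trans hj ks)).
  + by have := sqnode_lt al_uniq al_bnd h; rewrite e2 ltxx -ltnS => /(_ (leq_trans hi ks)).
- by rewrite size_mkseq.
Qed.

Definition psd_half (q : {poly R}) := psd_on_sphere n (fun t => t ^+ b * q.[t ^+ 2]).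

Lemma psd_half_cone : convex_cone psd_half.
Proof.
split=> [p q hp hq|c p c0 hp].
  by apply: psd_ext (psd_add hp hq) => t; rewrite hornerD mulrDr.
by apply: psd_ext (psd_scale c0 hp) => t; rewrite hornerZ mulrCA.
Qed.

Definition half_monic l : {poly R} := ((zonal_half R n b l)`_l)^-1 *: zonal_half R n b l.

(** The product of [zonalP (2 l + b)] and [t ^ b q (t ^ 2)] has
    degree at most [2 (size al).-1], so the design averages it exactly. *)
Lemma half_monic_orth l : (l < s.+1)%N -> [/\ monic_deg (half_monic l) l, psd_half (half_monic l) &
  forall q : {poly R}, (size q <= l)%N -> M (half_monic l * q) = 0].
Proof.
rewrite ltnS => ls; have [h1 h2] := pos_lead_zonal_half R n2 b l.
have hl : (zonal_half R n b l)`_l != 0 by rewrite gt_eqF.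
have sz : size (zonal_half R n b l) = l.+1.
  apply/eqP; rewrite eqn_leq h1 ltnNge; apply/negP => h.
  by move: hl; rewrite nth_default ?eqxx.
split.
- split; last by rewrite size_scale ?invr_eq0.
  by rewrite monicE lead_coefZ /lead_coef sz /= mulVf.
- have c0 : 0 <= ((zonal_half R n b l)`_l)^-1 by rewrite invr_ge0 ltW.
  apply: psd_ext (psd_scale c0 (@psd_zonalP R n n2 (2 * l + b)%N)) => t.
  by rewrite zonalP_half hornerM hornerXn horner_comp hornerXn /half_monic hornerZ mulrCA.
move=> q sq; have [->|q0] := eqVneq q 0.
  by rewrite mulr0 (lin_functional0 code_functional_linear).
rewrite code_functional_exact.
  rewrite /sq_mean.
  have -> : ('X^b * (half_monic l * q)) \Po 'X^2 =
      ((zonal_half R n b l)`_l)^-1 *: (Z (2 * l + b) * ('X^b * (q \Po 'X^2))).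
    rewrite zonalP_half /half_monic -scalerAl -scalerAr comp_polyZ !comp_polyM comp_Xn_poly.
    have -> : 'X^2 ^+ b = 'X^b * 'X^b :> {poly R} by rewrite -exprD addnn -mul2n exprM.
    by congr (_ *: _); ring.
  rewrite (lin_functionalZ (gegen_int_linear n2)) (gegen_int_zonalP n2) ?mulr0 ?mul0r //.
  apply: leq_trans (size_polyMleq _ _) _; rewrite size_polyXn.
  have := size_comp_poly_leq q 'X^2; rewrite size_polyXn -size_poly_gt0 in q0 *.
  by move=> hq; lia.
rewrite size_monicM ?monicXn //; last first.
  by rewrite mulf_neq0 // /half_monic scaler_eq0 invr_eq0 (negPf hl) -size_poly_eq0 sz.
rewrite size_polyXn size_mul // ?size_scale ?invr_eq0 // ?sz.
  rewrite size_alE //; move: sq ls; rewrite -size_poly_gt0 in q0 *.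
  by move: (size q) (size (posA al)) (nat_of_bool b) q0 => u v w; lia.
by rewrite /half_monic scaler_eq0 invr_eq0 (negPf hl) -size_poly_eq0 sz.
Qed.

Lemma psd_node_poly k : (k <= s)%N -> psd_half (node_poly r k).
Proof.
move=> ks; apply: (prefix_products_in_cone code_functional_linear psd_half_cone
  (p := half_monic) (N := s.+1)) => //.
- exact: code_functional_node_poly.
- exact: code_functional_pos.
- exact: half_monic_orth.
Qed.
End NodePolynomialsPSD.

(** * Energy bound and equality *)

Lemma dot_itv (R : realType) n (x y : 'rV[R]_n) : on_sphere x -> on_sphere y ->
  -1 <= dot x y <= 1.
Proof.
move=> xS yS.
have h (e : R) : e ^+ 2 = 1 -> 0 <= 2 + 2 * e * dot x y.
  move=> e2; have -> : 2 + 2 * e * dot x y = \sum_i (x 0 i + e * y 0 i) ^+ 2.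
    transitivity (dot x x + 2 * e * dot x y + e ^+ 2 * dot y y).
      by rewrite xS yS e2; ring.
    by rewrite /dot !mulr_sumr -!big_split; apply: eq_bigr => i _ /=; ring.
  by apply: sumr_ge0 => i _; exact: sqr_ge0.
have h1 := h 1 (expr1n _ _); have h2 := h (-1) (etrans (sqrrN _) (expr1n _ _)).
by apply/andP; split; lra.
Qed.

Lemma dot_sq_itv (R : realType) n (x y : 'rV[R]_n) : on_sphere x -> on_sphere y ->
  dot x y ^+ 2 \in `[0, 1]%R.
Proof.
by move=> xS yS; have /andP[h1 h2] := dot_itv xS yS; rewrite in_itv /= sqr_ge0 /=; nra.
Qed.

Section EnergyBound.
Variables (R : realType) (n N : nat) (al : seq R).
Hypotheses (n2 : (2 <= n)%N) (N0 : (0 < N)%N).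
Hypotheses (al_uniq : uniq al) (al_bnd : forall t, t \in al -> -1 < t < 1)
  (al_sym : forall t, t \in al -> - t \in al) (al0 : (0 < size al)%N).
Variable xs : 'I_N -> 'rV[R]_n.
Hypothesis xs_design : is_design (size al).-1 xs (@equi_weights R N).
Hypothesis xs_dots : forall i j, i != j -> dot (xs i) (xs j) \in al.
Variable f : R -> R.
Hypothesis f_cont : {within `[0, 1], continuous f}.
Hypothesis f_der : derivable_upto (size al) f.
Hypothesis f_ge0 : forall k : nat, (1 <= k <= size al)%N ->
     {in `]0, 1[, forall t : R, 0 <= derive1n k f t}.

Notation prefix i := (node_prod (take i (nodes al))).

(** The prefix of length [i] is the product of two node polynomials, of
    lengths [i./2] and [uphalf i]. If [0] is in [al], the first node [0]
    contributes [t ^ 2], one factor [t] for each of them. *)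
Lemma psd_prefix i : (i < size al)%N ->
  psd_on_sphere n (fun t => (prefix i).[t ^+ 2]).
Proof.
have psd k := psd_node_poly n2 N0 al_uniq al_bnd al_sym al0 xs_design xs_dots (k := k).
have half k : (k <= 2 * size (posA al))%N ->
    (k./2 <= size (posA al))%N /\ (uphalf k <= size (posA al))%N.
  by move=> hk; split; lia.
rewrite size_alE // /nodes; move: psd; rewrite /psd_half; case: (zeroA al) => psd.
  rewrite addn1 ltnS; case: i => [|i] hi.
    by apply: psd_ext (@psd_const1 R n) => t; rewrite /node_prod big_nil hornerC.
  have [h1 h2] := half i (ltnW hi).
  apply: psd_ext (psd_mul (psd _ h1) (psd _ h2)) => t.
  rewrite /= /node_prod big_cons subr0 -/(node_prod _) node_prod_take_doubled.
  by rewrite !node_prod_mkseq // hornerM hornerX hornerM !expr1; ring.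
rewrite addn0 => /ltnW/half[h1 h2].
apply: psd_ext (psd_mul (psd _ h1) (psd _ h2)) => t.
by rewrite node_prod_take_doubled !node_prod_mkseq // hornerM !expr0 !mul1r.
Qed.

Lemma prefix_energy_ge (x : 'I_N -> 'rV[R]_n) w i : weighted_code x w -> (i < size al)%N ->
  sq_mean n (prefix i) <= \sum_(k < N) \sum_(l < N) w k * w l * (prefix i).[dot (x k) (x l) ^+ 2].
Proof.
move=> [_ xS _ w1] im; have [[_ xsS _ ws1] _] := xs_design.
apply: (psd_energy_ge (psd_prefix im) xS xsS w1 ws1) => y yS.
apply: (design_exact n2 al0 xs_design) => //.
by rewrite size_prod_XsubC size_take size_nodes // im.
Qed.

Lemma node_prod_nodes_ge0 u : 0 <= u -> 0 <= (node_prod (nodes al)).[u].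
Proof.
by move=> u0; rewrite node_prod_nodesE mulr_ge0 ?sqr_ge0 // exprn_ge0.
Qed.

Variables (g : {poly R}).
Hypotheses (sg : (size g <= size al)%N) (hg : hermite_at f g (nodes al)).

(** The remainder has the sign of the node product, which is [u ^ b]
    times a square. *)
Lemma hermite_le u : u \in `[0, 1]%R -> g.[u] <= f u.
Proof.
move=> u01; have [uz|uz] := boolP (u \in nodes al); first by rewrite hg.1.
have [xi xi01 e] := hermite_remainder f_cont f_der (good_nodes_nodes al_uniq al_bnd)
  (size_nodes al_uniq al_sym) al0 sg hg u01 uz.
rewrite -subr_ge0 -(pmulr_lge0 _ (_ : 0 < (size al)`!%:R)) ?ltr0n ?fact_gt0 // e.
rewrite mulr_ge0 ?f_ge0 ?al0 ?leqnn // node_prod_nodes_ge0 //.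
by move: u01; rewrite in_itv /= => /andP[].
Qed.

Lemma hermite_lt u : {in `]0, 1[, forall t : R, 0 < derive1n (size al) f t} ->
  u \in `[0, 1]%R -> u \notin nodes al -> g.[u] < f u.
Proof.
move=> f_gt0 u01 uz.
have [xi xi01 e] := hermite_remainder f_cont f_der (good_nodes_nodes al_uniq al_bnd)
  (size_nodes al_uniq al_sym) al0 sg hg u01 uz.
rewrite -subr_gt0 -(pmulr_lgt0 _ (_ : 0 < (size al)`!%:R)) ?ltr0n ?fact_gt0 // e.
rewrite mulr_gt0 ?f_gt0 // lt_neqAle eq_sym node_prod_root uz node_prod_nodes_ge0 //.
by move: u01; rewrite in_itv /= => /andP[].
Qed.

Variable c : nat -> R.
Hypothesis gE : g = newton_form (nodes al) c.

(** On the diagonal, [\sum_k w k ^ 2 - 1 / N] is the sum of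
    the squares of [w k - 1 / N]. *)
Lemma energy_decomposition (x : 'I_N -> 'rV[R]_n) w : weighted_code x w ->
  energy f x w - (sq_mean n g + N%:R^-1 * (f 1 - g.[1])) =
  \sum_(i < size al) c i * (\sum_(k < N) \sum_(l < N)
      w k * w l * (prefix i).[dot (x k) (x l) ^+ 2] - sq_mean n (prefix i))
  + \sum_(k < N) \sum_(l < N | l != k) w k * w l *
      (f (dot (x k) (x l) ^+ 2) - g.[dot (x k) (x l) ^+ 2])
  + (f 1 - g.[1]) * \sum_(k < N) (w k - N%:R^-1) ^+ 2.
Proof.
move=> [_ xS _ w1].
have N0' : N%:R != 0 :> R by rewrite pnatr_eq0 -lt0n.
have -> : \sum_(k < N) (w k - N%:R^-1) ^+ 2 = \sum_(k < N) w k ^+ 2 - N%:R^-1.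
  transitivity (\sum_(k < N) w k ^+ 2 - 2 * N%:R^-1 * (\sum_(k < N) w k)
     + \sum_(k < N) N%:R^-1 ^+ 2).
    by rewrite mulr_sumr -sumrB -big_split; apply: eq_bigr => k _ /=; ring.
  by rewrite w1 sumr_const card_ord -mulr_natl; field.
have -> : \sum_(i < size al) c i * (\sum_(k < N) \sum_(l < N)
      w k * w l * (prefix i).[dot (x k) (x l) ^+ 2] - sq_mean n (prefix i)) =
   \sum_(k < N) \sum_(l < N) w k * w l * g.[dot (x k) (x l) ^+ 2] - sq_mean n g.
  under eq_bigr => i _ do rewrite mulrBr mulr_sumr.
  rewrite sumrB; congr (_ - _); last first.
    rewrite gE /newton_form size_nodes //.
    by rewrite (lin_functional_sum (sq_mean_linear n2)).
  rewrite exchange_big; apply: eq_bigr => k _ /=.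
  under eq_bigr => i _ do rewrite mulr_sumr.
  rewrite exchange_big; apply: eq_bigr => l _ /=.
  rewrite gE /newton_form size_nodes // horner_sum mulr_sumr; apply: eq_bigr => i _.
  by rewrite hornerZ mulrCA.
have -> : energy f x w = \sum_(k < N) \sum_(l < N) w k * w l * g.[dot (x k) (x l) ^+ 2]
  + \sum_(k < N) \sum_(l < N | l != k) w k * w l *
      (f (dot (x k) (x l) ^+ 2) - g.[dot (x k) (x l) ^+ 2])
  + (f 1 - g.[1]) * \sum_(k < N) w k ^+ 2.
  rewrite mulr_sumr -!big_split; apply: eq_bigr => k _ /=.
  rewrite -addrA [X in _ + X](_ : _ = \sum_l w k * w l *
      (f (dot (x k) (x l) ^+ 2) - g.[dot (x k) (x l) ^+ 2])).
    by rewrite -big_split; apply: eq_bigr => l _ /=; ring.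
  rewrite [RHS](bigD1 k) //= xS expr1n addrC; congr (_ + _); ring.
ring.
Qed.

Lemma sharp_energy (x : 'I_N -> 'rV[R]_n) :
  is_design (size al).-1 x (@equi_weights R N) ->
  (forall i j, i != j -> dot (x i) (x j) \in al) ->
  energy f x (@equi_weights R N) = sq_mean n g + N%:R^-1 * (f 1 - g.[1]).
Proof.
move=> des dots; have [wc _] := des.
apply/eqP; rewrite -subr_eq0 energy_decomposition //.
rewrite big1 ?add0r => [|i _]; last first.
  rewrite (design_exact2 n2 al0 des) ?subrr ?mulr0 //.
  by rewrite size_prod_XsubC size_take size_nodes // ltn_ord.
rewrite big1 ?add0r => [|k _]; last first.
  by rewrite big1 // => l lk; rewrite hg.1 ?subrr ?mulr0 // mem_sq_nodes // dots // eq_sym.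
by rewrite big1 ?mulr0 // => k _; rewrite subrr expr0n.
Qed.
End EnergyBound.

Section UniversalOptimality.
Variables (R : realType) (n N : nat) (al : seq R).
Hypotheses (n2 : (2 <= n)%N) (N0 : (0 < N)%N).
Hypotheses (al_uniq : uniq al) (al_bnd : forall t, t \in al -> -1 < t < 1)
  (al_sym : forall t, t \in al -> - t \in al) (al0 : (0 < size al)%N).
Variable xs : 'I_N -> 'rV[R]_n.
Hypothesis xs_design : is_design (size al).-1 xs (@equi_weights R N).
Hypothesis xs_dots : forall i j, i != j -> dot (xs i) (xs j) \in al.
Variable f : R -> R.
Hypothesis f_cont : {within `[0, 1], continuous f}.
Hypothesis f_der : derivable_upto (size al) f.
Hypothesis f_ge0 : forall k : nat, (1 <= k <= size al)%N ->
     {in `]0, 1[, forall t : R, 0 <= derive1n k f t}.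

Let good := good_nodes_nodes al_uniq al_bnd.
Let size_nodes_al := size_nodes al_uniq al_sym.
Let one01 : (1 : R) \in `[0, 1]%R. Proof. by rewrite in_itv /= ler01 lexx. Qed.

Variables (x : 'I_N -> 'rV[R]_n) (w : 'I_N -> R).
Hypothesis wc : weighted_code x w.

(** All the terms of [energy_decomposition] are nonnegative.
    In case of equality under strict positivity, the third one forces equal
    weights, the second one forces the inner products to lie in [al], as
    [g < f] outside the nodes, and the first one forces the energy of each
    prefix product, hence of each polynomial of degree less than [size al] in [u], to
    be its mean. *)
Lemma universal_optimality :
  energy f xs (@equi_weights R N) <= energy f x w /\
  ((forall k : nat, (1 <= k <= size al)%N ->
      {in `]0, 1[, forall t : R, 0 < derive1n k f t}) ->
    energy f x w = energy f xs (@equi_weights R N) ->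
    [/\ w =1 @equi_weights R N, is_design (size al).-1 x w &
        forall i j, i != j -> dot (x i) (x j) \in al]).
Proof.
have [c [hg hc]] := newton_hermite f_cont f_der good (eq_leq size_nodes_al).
pose g := newton_form (nodes al) c.
have sg : (size g <= size al)%N by rewrite -size_nodes_al; exact: size_newton_form.
have gE : g = newton_form (nodes al) c by [].
have [_ xS w0 w1] := wc.
have le_gf := hermite_le al_uniq al_bnd al_sym al0 f_cont f_der f_ge0 sg hg.
have c_ge0 i : (0 < i < size al)%N -> 0 <= c i.
  rewrite -size_nodes_al => hi; have [xi xi01 e] := hc i hi.
  rewrite -(pmulr_lge0 _ (_ : 0 < i`!%:R)) ?ltr0n ?fact_gt0 // -e.
  by apply: f_ge0 => //; case/andP: hi => -> /ltnW; rewrite size_nodes_al.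
have pre_ge i (hi : (i < size al)%N) :=
  prefix_energy_ge n2 N0 al_uniq al_bnd al_sym al0 xs_design xs_dots wc hi.
have prefix_size i : (i < size al)%N -> size (node_prod (take i (nodes al))) = i.+1.
  by move=> hi; rewrite size_prod_XsubC size_take size_nodes_al hi.
have mean1 : sq_mean n (1 : {poly R}) = 1.
  by rewrite /sq_mean comp_polyC divff // gt_eqF // gegen_int1_gt0.
(* c 0 has no sign, but the empty product is 1, of energy and mean 1 *)
have pre0 : \sum_(k < N) \sum_(l < N) w k * w l *
      (node_prod (take 0 (nodes al))).[dot (x k) (x l) ^+ 2] = sq_mean n (node_prod (take 0 (nodes al))).
  rewrite take0 /node_prod big_nil mean1.
  under eq_bigr => k _ do under eq_bigr => l _ do rewrite hornerC mulr1.
  by rewrite double_sum_sqr w1 expr1n.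
have := energy_decomposition n2 N0 al_uniq al_sym f gE wc.
rewrite -(sharp_energy n2 N0 al_uniq al_bnd al_sym al0 hg gE xs_design xs_dots).
set S1 := \sum_(i < size al) _; set S2 := \sum_(k < N) \sum_(l < N | _) _; set S3 := \sum_(k < N) _.
have t1 (i : 'I_(size al)) : 0 <= c i * (\sum_(k < N) \sum_(l < N)
      w k * w l * (node_prod (take i (nodes al))).[dot (x k) (x l) ^+ 2]
      - sq_mean n (node_prod (take i (nodes al)))).
  have [e|i0] := posnP i; first by rewrite e pre0 subrr mulr0.
  by rewrite mulr_ge0 ?subr_ge0 ?pre_ge ?c_ge0 ?i0 ?ltn_ord.
have t2 k l : 0 <= w k * w l * (f (dot (x k) (x l) ^+ 2) - g.[dot (x k) (x l) ^+ 2]).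
  by rewrite mulr_ge0 ?mulr_ge0 // subr_ge0 le_gf // dot_sq_itv.
have S1_ge0 : 0 <= S1 by apply: sumr_ge0 => i _.
have S2_ge0 : 0 <= S2 by apply: sumr_ge0 => k _; apply: sumr_ge0 => l _.
have S3_ge0 : 0 <= S3 by apply: sumr_ge0 => k _; exact: sqr_ge0.
have f1_ge0 : 0 <= f 1 - g.[1] by rewrite subr_ge0 (le_gf _ one01).
have S3'_ge0 : 0 <= (f 1 - g.[1]) * S3 by rewrite mulr_ge0.
move=> dec; split; first by rewrite -subr_ge0 dec !addr_ge0.
move=> f_gt0 eqE; move: dec; rewrite eqE subrr => /esym dec.
have [z1 z2 z3] : [/\ S1 = 0, S2 = 0 & (f 1 - g.[1]) * S3 = 0] by split; lra.
have fm_gt0 : {in `]0, 1[, forall t : R, 0 < derive1n (size al) f t}.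
  by apply: f_gt0; rewrite al0 leqnn.
have lt_gf u := hermite_lt al_uniq al_bnd al_sym al0 f_cont f_der sg hg (u := u) fm_gt0.
have f1_gt0 : 0 < f 1 - g.[1] by rewrite subr_gt0 (lt_gf _ one01) // one_notin_nodes.
have wE : w =1 @equi_weights R N.
  move=> k; apply/eqP; rewrite -subr_eq0 -sqrf_eq0; apply/eqP.
  have S30 : S3 = 0 by move/eqP: z3; rewrite mulf_eq0 gt_eqF //= => /eqP.
  by apply: (psumr_eq0P _ S30) => // l _; exact: sqr_ge0.
have w_gt0 k : 0 < w k by rewrite wE invr_gt0 ltr0n.
split=> //.
- apply: (exact_is_design n2 al0) => // p sp.
  suff : \sum_(k < N) \sum_(l < N) w k * w l * p.[dot (x k) (x l) ^+ 2] - sq_mean n p = 0.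
    by move=> /eqP; rewrite subr_eq0 => /eqP.
  move: p sp; apply: (poly_triangular_ind (p := fun i => node_prod (take i (nodes al)))).
  + rewrite (lin_functional0 (sq_mean_linear n2)) subr0 big1 // => k _.
    by rewrite big1 // => l _; rewrite horner0 mulr0.
  + move=> e p q hp hq; rewrite (sq_mean_linear n2).
    under eq_bigr => k _.
      under eq_bigr => l _ do rewrite hornerD hornerZ mulrDr mulrCA.
      rewrite big_split /= -mulr_sumr; over.
    rewrite big_split /= -mulr_sumr; move: hp hq => /eqP; rewrite subr_eq0 => /eqP ->.
    by move=> /eqP; rewrite subr_eq0 => /eqP ->; rewrite subrr.
  + move=> i hi; split; first by rewrite prefix_size.
      have /monicP : node_prod (take i (nodes al)) \is monic by exact: monic_prod_XsubC.
      by rewrite /lead_coef prefix_size //= => ->; exact: oner_neq0.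
    have [->|i0] := posnP i; first by rewrite pre0 subrr.
    have ci : c i != 0.
      have hi' : (0 < i < size (nodes al))%N by rewrite i0 size_nodes_al.
      have [xi xi01 e] := hc i hi'; apply/eqP => ci0.
      have : 0 < derive1n i f xi by apply: f_gt0 => //; rewrite i0 ltnW.
      by rewrite e ci0 mul0r ltxx.
    have h1 := psumr_eq0P (fun i _ => t1 i) z1; have /eqP := h1 (Ordinal hi) isT.
    by rewrite mulf_eq0 (negPf ci) => /eqP.
- move=> i j ij; rewrite -mem_sq_nodes //; apply: contraT => tn.
  have u01 := dot_sq_itv (xS i) (xS j).
  have := lt_gf _ u01 tn; rewrite -subr_gt0 => h.
  have e1 := psumr_eq0P (fun k _ => sumr_ge0 _ (fun l _ => t2 k l)) z2.
  have := psumr_eq0P (fun l _ => t2 i l) (e1 i isT).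
  move=> /(_ j).
  rewrite eq_sym ij => /(_ isT) /eqP.
  by rewrite gt_eqF // !mulr_gt0.
Qed.
End UniversalOptimality.

Theorem corollary7p5 (R : realType) (n m N : nat)
  (hn : (2 <= n)%N) (hm : (1 <= m)%N) (hN : (2 <= N)%N)
  (alpha : 'I_m -> R)
  (alpha_incr : forall i j : 'I_m, (i < j)%N -> alpha i < alpha j)
  (alpha_bnd : forall i : 'I_m, -1 < alpha i < 1)
  (alpha_sym : forall t : R, range alpha t -> range alpha (- t))
  (xs : 'I_N -> 'rV[R]_n)
  (xs_design : is_design m.-1 xs (@equi_weights R N))
  (xs_antipodal : no_antipodal_pairs xs)
  (xs_dots : dots_in (range alpha) xs)
  (f : R -> R)
  (f_cont : {within `[0, 1], continuous f})
  (f_der : derivable_upto m f)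
  (f_ge0 : forall k : nat, (1 <= k <= m)%N ->
     {in `]0, 1[, forall t : R, 0 <= derive1n k f t}) :
  [/\ energy f xs (@equi_weights R N) =
        1 / N%:R ^+ 2 *
          \sum_(i < N) \sum_(j < N) f (dot (xs i) (xs j) ^+ 2),
      forall (x : 'I_N -> 'rV[R]_n) (w : 'I_N -> R), weighted_code x w ->
        energy f x w >= energy f xs (@equi_weights R N)
    & (forall k : nat, (1 <= k <= m)%N ->
         {in `]0, 1[, forall t : R, 0 < derive1n k f t}) ->
      forall (x : 'I_N -> 'rV[R]_n) (w : 'I_N -> R), weighted_code x w ->
        (energy f x w = energy f xs (@equi_weights R N) <->
         [/\ w =1 @equi_weights R N,
             is_design m.-1 x w,
             no_antipodal_pairs x
           & dots_in (range alpha) x])].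
Proof.
have N0 : (0 < N)%N by exact: ltnW.
(* the set A as a list, of which m becomes the length *)
have [al [sz almem al_uniq]] : exists al : seq R,
    [/\ size al = m, forall t, range alpha t <-> t \in al & uniq al].
  exists (codom alpha); split.
  - by rewrite size_codom card_ord.
  - move=> t; split => [[i _ <-]|/codomP[i ->]]; first exact: codom_f.
    by exists i.
  - apply/injectiveP => i j e; apply/val_inj/eqP; case: ltngtP => //= ij.
    + by have := alpha_incr _ _ ij; rewrite e ltxx.
    + by have := alpha_incr _ _ ij; rewrite e ltxx.
have al_bnd t : t \in al -> -1 < t < 1 by move=> /almem[i _ <-]; exact: alpha_bnd.
have al_sym t : t \in al -> - t \in al by move=> /almem/alpha_sym/almem.
have dotsE (x : 'I_N -> 'rV[R]_n) :
    dots_in (range alpha) x <-> (forall i j, i != j -> dot (x i) (x j) \in al).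
  by split=> h i j ij; apply/almem; exact: h.
move: (range alpha) dotsE xs_dots => A dotsE /dotsE xs_dots_al {almem}.
move: alpha_incr alpha_bnd alpha_sym => _ _ _ {alpha}.
move: m sz hm xs_design f_der f_ge0 => m' <-{m'} al0 xs_design' f_der' f_ge0'.
have univ (x : 'I_N -> 'rV[R]_n) w (wc : weighted_code x w) := universal_optimality
  hn N0 al_uniq al_bnd al_sym al0 xs_design' xs_dots_al f_cont f_der' f_ge0' wc.
split.
- rewrite /energy mulr_sumr; apply: eq_bigr => i _; rewrite mulr_sumr.
  by apply: eq_bigr => j _; rewrite /equi_weights mul1r -exprVn expr2.
- by move=> x w wc; have [] := univ x w wc.
move=> f_gt0 x w wc; split => [e|[wE des _ /dotsE dots]].
  have [_ /(_ f_gt0 e)[wE des dots]] := univ x w wc.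
  split => //; last exact/dotsE.
  move=> i j; apply/eqP => xij; have [_ xS _ _] := wc.
  have dij : dot (x i) (x j) = -1.
    rewrite -(xS j) xij /dot -sumrN; apply: eq_bigr => k _.
    by rewrite !mxE mulNr.
  have [eij|ij] := eqVneq i j.
    by move: dij; rewrite eij xS => h; have : (0 : R) < 1 by []; lra.
  by have := al_bnd _ (dots i j ij); rewrite dij ltxx.
have -> : w = @equi_weights R N by apply/funext.
have des' : is_design (size al).-1 x (@equi_weights R N).
  by rewrite -(_ : w = @equi_weights R N) //; apply/funext.
have [c [hg _]] := newton_hermite f_cont f_der' (good_nodes_nodes al_uniq al_bnd)
  (eq_leq (size_nodes al_uniq al_sym)).
have sharp := sharp_energy hn N0 al_uniq al_bnd al_sym al0 hg erefl.
by rewrite (sharp x des' dots) (sharp xs xs_design' xs_dots_al).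
Qed.
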